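(* Let $d\geq2$ be an integer, $\alpha\in(0,d)$, $\beta>0$. Then for any $\varepsilon>0$ and $V>0$ the problem $$\min\left\{\mathcal{F}_\varepsilon(E)\,:\,E\subset\mathbb{R}^d \text{ a set of finite perimeter},\ |E|=V\right\}$$ admits a minimizer, where $$\mathcal{F}_\varepsilon(E):=\varepsilon\,\mathcal{P}(E)+\int_E\int_E\frac{1}{|x-y|^\alpha}\,\mathrm{d}x\,\mathrm{d}y+\int_E\int_E|x-y|^\beta\,\mathrm{d}x\,\mathrm{d}y.$$
   Context: $|\cdot|$ applied to sets is Lebesgue measure on $\mathbb{R}^d$ and $\mathcal{P}(E)$ is the perimeter of $E$ in the sense of Caccioppoli--De Giorgi. *)

(* Defs.v *)
From HB Require Import structures.
From mathcomp Require Import all_boot all_order all_algebra.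
From mathcomp Require Import all_classical all_reals all_analysis.

Set Implicit Arguments.
Unset Strict Implicit.
Unset Printing Implicit Defensive.

Import Order.TTheory GRing.Theory Num.Theory.
Import numFieldNormedType.Exports.

Local Open Scope classical_set_scope.
Local Open Scope ring_scope.

(* The library's sigma-finiteness instance for [\x] is shadowed by the one for
   subprobabilities, so that it cannot be inferred. *)
Lemma product_measure1_sigma_finite d1 d2 (T1 : measurableType d1)
    (T2 : measurableType d2) (R : realType)
    (m1 : {sigma_finite_measure set T1 -> \bar R})
    (m2 : {sigma_finite_measure set T2 -> \bar R}) :
  sigma_finite setT (m1 \x m2)%E.
Proof.
have /sigma_finiteP[F [TF ndF Foo]] := sigma_finiteT m1.
have /sigma_finiteP[G [TG ndG Goo]] := sigma_finiteT m2.
exists (fun n => F n `*` G n).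
  rewrite -setXTT TF TG predeqE => -[x y]; split.
    move=> [/= [n _ Fnx] [k _ Gky]]; exists (maxn n k) => //; split.
    - by move: x Fnx; exact/subsetPset/ndF/leq_maxl.
    - by move: y Gky; exact/subsetPset/ndG/leq_maxr.
  by move=> [n _ []/= ? ?]; split; exists n.
move=> k; have [mF Fk] := Foo k; have [mG Gk] := Goo k.
split; first exact: measurableX.
by rewrite product_measure1E// lte_mul_pinfty// ge0_fin_numE.
Qed.

Lemma pushforward_sigma_finite d1 d2 (T1 : measurableType d1)
    (T2 : measurableType d2) (R : realType)
    (m : {sigma_finite_measure set T1 -> \bar R}) (f : T1 -> T2) (g : T2 -> T1) :
  measurable_fun setT f -> measurable_fun setT g -> cancel f g ->
  exists m' : {sigma_finite_measure set T2 -> \bar R}, pushforward m f = m'.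
Proof.
move=> mf mg fgK.
pose nu : {measure set T2 -> \bar R} :=
  measure_function_pushforward__canonical__measure_function_Measure m mf.
have sf : sigma_finite setT nu.
  have [F FT Foo] := sigma_finiteT m.
  exists (fun k => g @^-1` F k).
    by rewrite -preimage_bigcup -FT preimage_setT.
  move=> k; have [mF muF] := Foo k; split.
    by rewrite -[X in measurable X]setTI; exact: mg.
  rewrite /nu /= /pushforward -comp_preimage.
  by rewrite (_ : _ \o _ = id) ?preimage_id//; apply/funext => x; exact: fgK.
pose sfnu := Measure_isSigmaFinite.Build _ _ _ nu sf.
pose nu' : {sigma_finite_measure set _ -> \bar R} :=
  HB.pack (Measure.sort nu) nu sfnu.
by exists nu'.
Qed.

Definition measure_rV_display : measure_display.
Proof. exact: default_measure_display. Qed.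

Section borel_rV.
Context {R : realType}.

Definition rV_coord n (i : 'I_n) (x : 'rV[R]_n) : measurableTypeR R := x ord0 i.

Section sigma_algebra.
Variable n : nat.

Let rV_set0 : g_sigma_preimage (@rV_coord n) set0.
Proof. exact: sigma_algebra0. Qed.

Let rV_setC A : g_sigma_preimage (@rV_coord n) A ->
  g_sigma_preimage (@rV_coord n) (~` A).
Proof. exact: sigma_algebraC. Qed.

Let rV_bigcup (F : _^nat) : (forall i, g_sigma_preimage (@rV_coord n) (F i)) ->
  g_sigma_preimage (@rV_coord n) (\bigcup_i (F i)).
Proof. exact: sigma_algebra_bigcup. Qed.

(* The coordinates generate the Borel sigma-algebra of R^n. *)
HB.instance Definition _ := @isMeasurable.Build measure_rV_display
  'rV[R]_n (g_sigma_preimage (@rV_coord n)) rV_set0 rV_setC rV_bigcup.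

End sigma_algebra.

Lemma measurable_rV_coord n (i : 'I_n) : measurable_fun setT (@rV_coord n i).
Proof.
move=> _ Y mY; rewrite setTI; apply: sub_sigma_algebra => /=.
rewrite -bigcup_seq/=; exists i => /=; first by rewrite mem_index_enum.
by exists Y => //; rewrite setTI.
Qed.

Lemma measurable_fun_rV d (T : measurableType d) n (f : T -> 'rV[R]_n) :
  (forall i, measurable_fun setT (@rV_coord n i \o f)) -> measurable_fun setT f.
Proof.
move=> mf.
suff H : preimage_set_system setT f (g_sigma_preimage (@rV_coord n))
    `<=` measurable by move=> _ A mA; apply: H; exists A.
rewrite -g_sigma_preimage_comp.
apply: smallest_sub; first exact: sigma_algebra_measurable.
case: n f mf => [|n] f mf; first by rewrite big_ord0.
rewrite -bigcup_mkord_ord; apply: bigcup_sub => i Ii.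
by move=> A [B mB <-]; exact: mf.
Qed.

Definition rV_cons n (p : R * 'rV[R]_n) : 'rV[R]_n.+1 :=
  row_mx (p.1%:M : 'rV_1) p.2.

Definition rV_uncons n (x : 'rV[R]_n.+1) : R * 'rV[R]_n :=
  (x ord0 ord0, rsubmx (x : 'rV_(1 + n))).

Fixpoint borel_lebesgue n : set 'rV[R]_n -> \bar R :=
  match n with
  | 0 => \d_(0 : 'rV[R]_0)
  | m.+1 =>
      pushforward (@lebesgue_measure R \x @borel_lebesgue m)%E (@rV_cons m)
  end.

Lemma rV_consK n : cancel (@rV_cons n) (@rV_uncons n).
Proof.
move=> [a x]; rewrite /rV_cons /rV_uncons /= row_mxKr; congr (_, _).
by rewrite mxE; case: splitP => // j _; rewrite !ord1 mxE eqxx.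
Qed.

Lemma measurable_rV_cons n :
  measurable_fun setT (@rV_cons n : measurableTypeR R * 'rV[R]_n -> 'rV[R]_n.+1).
Proof.
apply: measurable_fun_rV => i.
case Ei: (fintype.split (i : 'I_(1 + n))) => [j|j].
  rewrite (_ : _ \o _ = fst)//; apply/funext => -[a x].
  by rewrite /rV_coord /rV_cons /= mxE Ei !ord1 mxE eqxx.
rewrite (_ : _ \o _ = @rV_coord n j \o snd).
  by apply: measurableT_comp => //; exact: measurable_rV_coord.
by apply/funext => -[a x]; rewrite /rV_coord /rV_cons /= mxE Ei.
Qed.

Lemma measurable_rV_uncons n :
  measurable_fun setT (@rV_uncons n : 'rV[R]_n.+1 -> measurableTypeR R * 'rV[R]_n).
Proof.
apply/measurable_fun_pairP; split.
  exact: (@measurable_rV_coord n.+1 ord0).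
apply: measurable_fun_rV => j.
rewrite (_ : _ \o _ = @rV_coord n.+1 (rshift 1 j)).
  exact: measurable_rV_coord.
by apply/funext => x; rewrite /rV_coord /= mxE.
Qed.

Lemma borel_lebesgue_sigma_finite n :
  exists m : {sigma_finite_measure set 'rV[R]_n -> \bar R},
    @borel_lebesgue n = m.
Proof.
elim: n => [|n [m mE]].
  by exists (\d_(0 : 'rV[R]_0)).
pose mu := [the {measure set _ -> \bar R} of (@lebesgue_measure R \x m)%E].
have sf : sigma_finite setT mu by exact: product_measure1_sigma_finite.
pose smu : {sigma_finite_measure set _ -> \bar R} :=
  HB.pack (Measure.sort mu) mu (Measure_isSigmaFinite.Build _ _ _ mu sf).
have [m' m'E] := pushforward_sigma_finite smu (@measurable_rV_cons n)
  (@measurable_rV_uncons n) (@rV_consK n).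
by exists m'; rewrite -m'E /= mE.
Qed.

Section lebesgue_instances.
Variable n : nat.

Let borel_lebesgue0 : @borel_lebesgue n set0 = 0%E.
Proof. by have [m ->] := borel_lebesgue_sigma_finite n; exact: measure0. Qed.

Let borel_lebesgue_ge0 A : (0 <= @borel_lebesgue n A)%E.
Proof. by have [m ->] := borel_lebesgue_sigma_finite n; exact: measure_ge0. Qed.

Let borel_lebesgue_sigma_additive : semi_sigma_additive (@borel_lebesgue n).
Proof.
have [m ->] := borel_lebesgue_sigma_finite n.
exact: measure_semi_sigma_additive.
Qed.

HB.instance Definition _ := isMeasure.Build _ _ _ (@borel_lebesgue n)
  borel_lebesgue0 borel_lebesgue_ge0 borel_lebesgue_sigma_additive.

Let borel_lebesgue_sfin : sigma_finite setT (@borel_lebesgue n).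
Proof. by have [m ->] := borel_lebesgue_sigma_finite n; exact: sigma_finiteT. Qed.

HB.instance Definition _ :=
  Measure_isSigmaFinite.Build _ _ _ (@borel_lebesgue n) borel_lebesgue_sfin.

End lebesgue_instances.

End borel_rV.

(* Defined on all Lebesgue measurable sets, in the same way as the library's
   [completed_lebesgue_measure] on R. *)
Section lebesgue_rV.
Context {R : realType} {d : nat}.

Definition lebesgue_rV :=
  @completed_measure_extension _ 'rV[R]_d R (@borel_lebesgue R d).

HB.instance Definition _ := Measure.on lebesgue_rV.

Let lebesgue_rV_sigma_finite : sigma_finite setT lebesgue_rV.
Proof.
exact: (completed_measure_extension_sigma_finite
  (sigma_finiteT (@borel_lebesgue R d))).
Qed.

HB.instance Definition _ :=
  Measure_isSigmaFinite.Build _ _ _ lebesgue_rV lebesgue_rV_sigma_finite.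

Definition lebesgue_measurable : set (set 'rV[R]_d) :=
  ((@borel_lebesgue R d)^*)%mu.-cara.-measurable.

End lebesgue_rV.

Section perimeter.
Context {R : realType} {d : nat}.
Local Notation Rd := 'rV[R]_d.

(* The library's norm on row vectors is the sup norm. *)
Definition enorm (x : Rd) : R := Num.sqrt (\sum_(i < d) x ord0 i ^+ 2).

Definition div_field (phi : Rd -> Rd) (x : Rd) : R :=
  \sum_(i < d) ('D_(delta_mx ord0 i) phi x) ord0 i.

Definition C1 (phi : Rd -> Rd) :=
  (forall x, differentiable phi x) /\ forall v, continuous ('D_v phi).

Definition compactly_supported (phi : Rd -> Rd) :=
  compact (closure [set x | phi x != 0]).

Definition perimeter (E : set Rd) : \bar R :=
  ereal_sup [set (\int[lebesgue_rV]_(x in E) (div_field phi x)%:E)%E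
    | phi in [set phi : Rd -> Rd | [/\ C1 phi, compactly_supported phi
                                    & forall x, enorm (phi x) <= 1]]].

Definition finite_perimeter (E : set Rd) :=
  lebesgue_measurable E /\ (perimeter E < +oo)%E.

(* At x = y the integrand |x - y|^-alpha takes the value 0 here instead of +oo;
   the diagonal is negligible. *)
Definition energy (eps alpha beta : R) (E : set Rd) : \bar R :=
  (eps%:E * perimeter E
   + \int[lebesgue_rV]_(y in E) \int[lebesgue_rV]_(x in E)
       ((enorm ((x : Rd) - y) `^ alpha)^-1)%:E
   + \int[lebesgue_rV]_(y in E) \int[lebesgue_rV]_(x in E)
       (enorm ((x : Rd) - y) `^ beta)%:E)%E.

End perimeter.

(* Main.v *)
Require Import Defs.
From mathcomp Require Import all_boot all_order all_algebra.
From mathcomp Require Import all_classical all_reals all_analysis.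
From mathcomp Require Import measurable_realfun.
From mathcomp Require Import ring lra.

(** The direct method.  If every competitor has infinite energy, any set of
    finite perimeter and volume [V], for instance a cube, is a minimizer.
    Otherwise take a minimizing sequence; the three terms of the energy are
    nonnegative, hence separately bounded along it.

    - The bound on the interaction with the growing kernel [|x - y| ^ beta],
      together with the fixed volume, gives a point of each set around which the
      [beta]-moment is bounded ([exists_center_bounded_moment]).  All terms are
      invariant under translations, so this point may be moved to the origin,
      and then no mass escapes to infinity ([measure_far_le]).

    - The bound on the perimeter gives compactness.  Testing the perimeter with
      fields carried by one axis bounds the measure of [E] minus its translate
      by the length of the translation times the perimeter
      ([shift_defect_le]).  Averaging over the vectors joining two points of a cube gives a
      Poincare inequality on the cubes of a grid ([poincare_cubes]): up to an
      error of the order of the mesh, a set of bounded perimeter is determined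
      in measure by the finitely many numbers [mu (E `&` Q)], for [Q] in the
      grid ([measure_setD_grid_le]).  These numbers converge along an
      ultrafilter, so the sequence has a subsequence that is rapidly Cauchy for
      the measure of the symmetric difference, and its limit inferior is its
      limit ([compactness_tight_perimeter]).

    - The energy is lower semicontinuous for this convergence
      ([minimizing_sequence_limit]).  The perimeter is a supremum of integrals
      of bounded functions, which pass to the limit.  The interactions are
      increasing in the set and the limit is an increasing union of sets
      contained in the tail members of the sequence, so monotone convergence
      applies.

    The argument is carried out on Borel sets.  A Lebesgue measurable set of
    finite measure differs from a Borel set by a null set, and the energy does
    not see null sets ([energy_hull]). *)

Set Implicit Arguments.
Unset Strict Implicit.
Unset Printing Implicit Defensive.

Import Order.TTheory GRing.Theory Num.Theory.
Import numFieldNormedType.Exports.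

Local Open Scope classical_set_scope.
Local Open Scope ring_scope.

(** * Borel sets and Lebesgue measurable sets *)

Section completion.
Context {R : realType} {n : nat}.
Local Notation Rn := 'rV[R]_n.
Local Notation mu := (@borel_lebesgue R n).

Lemma lebesgue_rV_borel (A : set Rn) : measurable A -> lebesgue_rV A = mu A.
Proof.
by move=> mA; rewrite /lebesgue_rV /completed_measure_extension measurable_mu_extE.
Qed.

Lemma borel_lebesgue_measurable (A : set Rn) :
  measurable A -> @lebesgue_measurable R n A.
Proof. exact: caratheodory_measurable_mu_ext. Qed.

(** The intersection of countable Borel covers whose measures tend to the
    outer measure of [E]. Finiteness turns the equality of the measures into
    a null difference. *)
Lemma borel_hull (E : set Rn) : lebesgue_measurable E ->
  (lebesgue_rV E < +oo)%E ->
  exists B, [/\ measurable B, E `<=` B & lebesgue_rV (B `\` E) = 0%E].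
Proof.
move=> mE Eoo.
have Efin : lebesgue_rV E \is a fin_num by rewrite ge0_fin_numE.
have cover k : exists U, [/\ measurable U, E `<=` U &
    (mu U <= lebesgue_rV E + k.+1%:R^-1%:E)%E].
  have := @lb_ereal_inf_adherent R
    [set (\sum_(0 <= k <oo) mu (A k))%E | A in measurable_cover E]
    (k.+1%:R^-1) ltac:(by rewrite invr_gt0) Efin.
  move=> [_ [A [mA EA] <-] ltA]; exists (\bigcup_k A k); split => //.
    exact: bigcupT_measurable.
  apply: le_trans (ltW ltA).
  apply: measure_sigma_subadditive => //.
  exact: bigcupT_measurable.
pose U k := projT1 (cid (cover k)).
have UP k := projT2 (cid (cover k)).
have mU : measurable (\bigcap_k U k).
  by apply: bigcapT_measurable => k; have [] := UP k.
exists (\bigcap_k U k); split => //.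
  by move=> x Ex k _; have [_ EU _] := UP k; exact: EU.
have mB := borel_lebesgue_measurable mU.
have EB : E `<=` \bigcap_k U k.
  by move=> x Ex k _; have [_ EU _] := UP k; exact: EU.
have := @measureD _ _ _ (@lebesgue_rV R n) _ _ mB mE.
rewrite (setIidr EB) => H.
have leB : (lebesgue_rV (\bigcap_k U k) <= lebesgue_rV E)%E.
  apply/lee_addgt0Pr => e e0.
  have [k kP] : exists k, k.+1%:R^-1 < e.
    by have [k _ /(_ _ (leqnn k))] := near_infty_natSinv_lt (PosNum e0);
      exists k.
  rewrite lebesgue_rV_borel//.
  have [mUk _ leU] := UP k.
  apply: (@le_trans _ _ (mu (U k))).
    by apply: le_measure; rewrite ?inE//; exact: bigcap_inf.
  by apply: (le_trans leU); rewrite leeD2l// lee_fin ltW.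
have Boo : (lebesgue_rV (\bigcap_k U k) < +oo)%E by apply: le_lt_trans Eoo.
rewrite H//; apply/eqP; rewrite eq_le; apply/andP; split.
  by rewrite leeBlDl// adde0.
by rewrite sube_ge0 ?Efin//; apply: le_measure; rewrite ?inE.
Qed.

Lemma measurable_fun_lebesgue (f : Rn -> \bar R)
    (D : set Rn) : measurable_fun D f -> measurable D ->
  @measurable_fun _ _ (caratheodory_type (mu^*)%mu) _ D f.
Proof.
move=> mf mD _ Y mY; apply: borel_lebesgue_measurable.
exact: mf.
Qed.

Lemma ge0_integral_lebesgue_rV (B : set Rn) (f : Rn -> \bar R) :
  measurable B -> measurable_fun setT f -> (forall x, 0 <= f x)%E ->
  (\int[lebesgue_rV]_(x in B) f x = \int[mu]_(x in B) f x)%E.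
Proof.
move=> mB mf f0.
pose i : caratheodory_type (mu^*)%mu -> Rn := idfun.
have mi : measurable_fun setT i.
  by move=> _ Y mY; rewrite setTI; exact: borel_lebesgue_measurable.
transitivity (\int[pushforward (@lebesgue_rV R n) i]_(x in B) f x)%E.
  by rewrite ge0_integral_pushforward//; exact: measurable_funTS.
apply: eq_measure_integral => A mA _.
by rewrite /pushforward; exact: lebesgue_rV_borel.
Qed.

(** Every integral in the energy of a Lebesgue measurable set is thereby an
    integral of a Borel function over a Borel set, to which Fubini's theorem
    for [borel_lebesgue] applies. *)
Lemma integral_lebesgue_rV (E B : set Rn) (f : Rn -> \bar R) :
  lebesgue_measurable E -> measurable B -> E `<=` B ->
  lebesgue_rV (B `\` E) = 0%E -> measurable_fun setT f ->
  (\int[lebesgue_rV]_(x in E) f x = \int[mu]_(x in B) f x)%E.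
Proof.
move=> mE mB EB N0.
have mB' := borel_lebesgue_measurable mB.
have ge0 (g : Rn -> \bar R) : measurable_fun setT g -> (forall x, 0 <= g x)%E ->
    (\int[lebesgue_rV]_(x in E) g x = \int[mu]_(x in B) g x)%E.
  move=> mg g0; rewrite -ge0_integral_lebesgue_rV//.
  rewrite [RHS](@ge0_negligible_integral _ _ _ (@lebesgue_rV R n) B
    (B `\` E))//.
  - by rewrite setDD setIidr.
  - exact: measurableD.
  - by apply: measurable_fun_lebesgue => //; exact: measurable_funTS.
move=> mf; rewrite integralE [RHS]integralE ge0 ?ge0//.
- exact: measurable_funeneg.
- exact: measurable_funepos.
Qed.

End completion.

(** * Translations and boxes *)

Lemma lebesgue_measure_shift {R : realType} (a : R) (A : set R) :
  measurable A ->
  lebesgue_measure ((fun t : R => t + a) @^-1` A) = lebesgue_measure A.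
Proof.
move=> mA.
pose s : measurableTypeR R -> measurableTypeR R := fun t => t + a.
have ms : measurable_fun setT s by exact: measurable_funD.
pose nu : {measure set (measurableTypeR R) -> \bar R} :=
  measure_function_pushforward__canonical__measure_function_Measure
    (@lebesgue_measure R) ms.
rewrite -[LHS]/(nu A); apply/esym/lebesgue_measure_unique => // _ [[x y]] _ <-.
rewrite /nu /= /pushforward.
rewrite (_ : s @^-1` _ = [set` `]x - a, y - a]]); last first.
  by apply/seteqP; split => t /=; rewrite /s !in_itv/= ltrBlDr lerBrDr.
by rewrite !lebesgue_measure_itv/= !lte_fin; congr (if _ then _ else _);
  [lra|congr (_%:E); lra].
Qed.

Section translation.
Context {R : realType}.

Lemma measurable_rV_add n (v : 'rV[R]_n) : measurable_fun setT
  (fun x : 'rV[R]_n => x + v : 'rV[R]_n).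
Proof.
apply: measurable_fun_rV => i.
rewrite (_ : _ \o _ = (fun x => rV_coord i x + v ord0 i)).
  apply: measurable_funD => //; exact: measurable_rV_coord.
by apply/funext => x; rewrite /rV_coord /= mxE.
Qed.

(** The sections of a translate are translates of the sections, so induction
    on the dimension reduces the claim to the line. *)
Lemma borel_lebesgue_shift n (v : 'rV[R]_n) (A : set 'rV[R]_n) :
  measurable A -> borel_lebesgue ((fun x => x + v) @^-1` A) = borel_lebesgue A.
Proof.
elim: n v A => [|n IH] v A mA.
  congr borel_lebesgue; apply/seteqP; split => x /=.
    by rewrite (_ : x + v = x)//; apply/matrixP => i [].
  by rewrite (_ : x + v = x)//; apply/matrixP => i [].
rewrite /= /pushforward /product_measure1.
set B := rV_cons (n:=n) @^-1` A.
have mB : measurable (B : set (measurableTypeR R * 'rV[R]_n)).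
  by rewrite -[B]setTI; exact: measurable_rV_cons.
pose g (t : measurableTypeR R) := @borel_lebesgue R n (xsection B t).
have mg : measurable_fun setT g.
  exact: (measurable_fun_xsection (@borel_lebesgue R n)).
pose s : measurableTypeR R -> measurableTypeR R := fun t => t + v ord0 ord0.
transitivity (\int[@lebesgue_measure R]_(t in setT) (g (s t)))%E.
  apply: eq_integral => t _ /=; rewrite /g /s.
  rewrite -[RHS](IH (rsubmx (v : 'rV_(1 + n))));
    last exact: measurable_xsection.
  congr borel_lebesgue.
  suff E z : rV_cons (t, z) + v =
      rV_cons (t + v ord0 ord0, z + rsubmx (v : 'rV_(1 + n))).
    by apply/seteqP; split => z; rewrite /xsection /= !inE /B /= E.
  apply/rowP => i; rewrite /rV_cons !mxE.
  case: splitP => j ij; rewrite !mxE.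
    have -> : i = ord0 by apply/val_inj; rewrite /= ij ord1.
    by rewrite !ord1 eqxx !mulr1n.
  by congr (_ + v _ _); apply/val_inj.
have ms : measurable_fun setT s by exact: measurable_funD.
rewrite -[LHS]/(\int[lebesgue_measure]_(t in s @^-1` setT) ((g \o s) t))%E.
rewrite -ge0_integral_pushforward//.
by apply: eq_measure_integral => C mC _; exact: lebesgue_measure_shift.
Qed.

End translation.

Section borel.
Context {R : realType}.

Lemma ge0_integral_shift n (v : 'rV[R]_n) (D : set 'rV[R]_n)
    (f : 'rV[R]_n -> \bar R) :
  measurable D -> measurable_fun setT f -> (forall x, 0 <= f x)%E ->
  (\int[@borel_lebesgue R n]_(x in (fun x : 'rV[R]_n =>
    x + v)%R @^-1` D) f (x + v)%R =
   \int[@borel_lebesgue R n]_(x in D) f x)%E.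
Proof.
move=> mD mf f0.
pose s : 'rV[R]_n -> 'rV[R]_n := fun x => x + v.
have ms : measurable_fun setT s := measurable_rV_add v.
rewrite -[LHS]/(\int[@borel_lebesgue R n]_(x in s @^-1` D) (f \o s) x)%E.
rewrite -ge0_integral_pushforward//; last exact: measurable_funTS.
by apply: eq_measure_integral => C mC _; exact: borel_lebesgue_shift.
Qed.

Lemma integral_shift n (v : 'rV[R]_n) (D : set 'rV[R]_n)
    (f : 'rV[R]_n -> \bar R) :
  measurable D -> measurable_fun setT f ->
  (\int[@borel_lebesgue R n]_(x in (fun x : 'rV[R]_n =>
    x + v)%R @^-1` D) f (x + v)%R =
   \int[@borel_lebesgue R n]_(x in D) f x)%E.
Proof.
move=> mD mf; rewrite integralE [RHS]integralE.
have mp := measurable_funepos mf; have mn := measurable_funeneg mf.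
have p0 x : (0 <= f^\+ x)%E by exact: funepos_ge0.
have n0 x : (0 <= f^\- x)%E by exact: funeneg_ge0.
congr (_ - _)%E.
  rewrite -[RHS](ge0_integral_shift v mD mp p0).
  by apply: eq_integral => x _; rewrite [LHS]funeposE [RHS]funeposE.
rewrite -[RHS](ge0_integral_shift v mD mn n0).
by apply: eq_integral => x _; rewrite [LHS]funenegE [RHS]funenegE.
Qed.

Definition box n (a b : 'I_n -> R) : set 'rV[R]_n :=
  [set x | forall i, a i <= x ord0 i < b i].

Lemma measurable_coord_itv n (i : 'I_n) (J : set R) : measurable J ->
  measurable [set x : 'rV[R]_n | J (x ord0 i)].
Proof.
move=> mJ; have := @measurable_rV_coord R n i measurableT J mJ.
by rewrite setTI.
Qed.

Lemma measurable_box n (a b : 'I_n -> R) : measurable (box a b).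
Proof.
rewrite (_ : box a b = \big[setI/setT]_(i < n)
    [set x : 'rV[R]_n | `[a i, b i[%classic (x ord0 i)]).
  have mi (i : 'I_n) : true ->
      measurable [set x : 'rV[R]_n | `[a i, b i[%classic (x ord0 i)].
    by move=> _; exact: (measurable_coord_itv i (measurable_itv `[a i, b i[)).
  exact: (bigsetI_measurable (index_enum 'I_n) mi).
apply/seteqP; split => x.
  by move=> bx; rewrite -bigcap_seq => i _ /=; rewrite in_itv/= bx.
rewrite -bigcap_seq => bx i; have := bx i; rewrite /= in_itv/=; apply.
by rewrite mem_index_enum.
Qed.

Lemma borel_lebesgue_box n (a b : 'I_n -> R) : (forall i, a i <= b i) ->
  borel_lebesgue (box a b) = (\prod_(i < n) (b i - a i))%:E.
Proof.
elim: n a b => [|n IH] a b ab.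
  by rewrite big_ord0 /= diracE mem_set// => -[].
rewrite /= /pushforward.
rewrite (_ : _ @^-1` _ = `[a ord0, b ord0[%classic `*`
   box (fun i => a (lift ord0 i)) (fun i => b (lift ord0 i))).
  rewrite product_measure1E//; last exact: measurable_box.
  rewrite big_ord_recl EFinM; congr (_ * _)%E; last exact: IH.
  transitivity (@lebesgue_measure R `[a ord0, b ord0[%classic) => //.
  rewrite lebesgue_measure_itv/= lte_fin; case: ltP => // ba.
  have -> : b ord0 = a ord0 by apply/eqP; rewrite eq_le ba ab.
  by rewrite subrr.
have E0 (t : R) (z : 'rV[R]_n) : rV_cons (t, z) ord0 ord0 = t.
  by have := rV_consK (t, z) => -[].
have ES (t : R) (z : 'rV[R]_n) i : rV_cons (t, z) ord0 (lift ord0 i) = z ord0 i.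
  have := rV_consK (t, z) => -[] _ /(congr1 (fun w : 'rV[R]_n => w ord0 i)) <-.
  by rewrite [RHS]mxE; congr (rV_cons _ _ _); exact/val_inj.
apply/seteqP; split => -[t z] /=.
  move=> H; split; first by have := H ord0; rewrite E0 in_itv/=.
  by move=> i; have := H (lift ord0 i); rewrite ES.
rewrite in_itv/= => -[tab zab] i.
by case: (unliftP ord0 i) => [j|] ->; rewrite ?ES ?E0.
Qed.

Lemma measurable_rV_sub n : measurable_fun setT
  (fun p : 'rV[R]_n * 'rV[R]_n => p.1 - p.2 : 'rV[R]_n).
Proof.
apply: measurable_fun_rV => i.
rewrite (_ : _ \o _ = (fun p => rV_coord i p.1 - rV_coord i p.2)).
  apply: measurable_funB.
  - exact: (measurableT_comp (measurable_rV_coord i) measurable_fst).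
  - exact: (measurableT_comp (measurable_rV_coord i) measurable_snd).
by apply/funext => x; rewrite /rV_coord /= !mxE.
Qed.

Lemma measurable_enorm n : measurable_fun setT (@enorm R n).
Proof.
have ms : measurable_fun setT (@Num.sqrt R).
  by apply: continuous_measurable_fun; exact: sqrt_continuous.
apply: (measurableT_comp ms); apply: measurable_sum => i.
by apply: measurable_funX; exact: measurable_rV_coord.
Qed.

(** Rounding to the grid of mesh [1 / k.+1] takes countably many values, each
    on a box, and [f] is the pointwise limit of its composites with it. *)
Lemma continuous_measurable_rV n (f : 'rV[R]_n -> R) :
  continuous f -> measurable_fun setT f.
Proof.
move=> cf.
pose pt (k : nat) (z : 'rV[int]_n) : 'rV[R]_n :=
  \row_i ((z ord0 i)%:~R / k.+1%:R).
pose rd (k : nat) (x : 'rV[R]_n) : 'rV[int]_n :=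
  \row_i Num.floor (x ord0 i * k.+1%:R).
have k0 (k : nat) : 0 < k.+1%:R :> R by [].
have rdP x : pt k (rd k x) @[k --> \oo] --> x.
  apply/cvg_ballP => e e0.
  have [N _ NP] := near_infty_natSinv_lt (PosNum e0).
  exists N => // k /= Nk; split => // i j; rewrite !mxE !ord1 /ball /=.
  apply: le_lt_trans (NP _ Nk).
  have /andP[] := floor_itv (x ord0 j * k.+1%:R).
  set z := Num.floor _ => h1 h2.
  have -> : x ord0 j - z%:~R / k.+1%:R = (x ord0 j * k.+1%:R - z%:~R) / k.+1%:R.
    by rewrite mulrBl mulfK// gt_eqF.
  rewrite normrM (gtr0_norm (x := _^-1)) ?invr_gt0// ler_piMl ?invr_ge0 ?ltW//.
  rewrite ger0_norm ?subr_ge0//.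
  by move: h2; rewrite intrD /=; lra.
apply: (@measurable_fun_cvg _ _ _ _ (fun k x => f (pt k (rd k x)))); last first.
  by move=> x _; apply: cvg_comp (rdP x) (cf x).
move=> k _ Y mY; rewrite setTI.
pose cell z := box (fun i => pt k z ord0 i) (fun i =>
  ((z ord0 i + 1)%:~R / k.+1%:R)).
have cellP x z : cell z x <-> rd k x = z.
  split.
    move=> H; apply/rowP => i; rewrite mxE.
    have := H i; rewrite /pt !mxE ler_pdivrMr// ltr_pdivlMr// => /floor_def.
    by [].
  move=> <- i; rewrite /pt !mxE ler_pdivrMr// ltr_pdivlMr//; exact: floor_itv.
rewrite (_ : _ @^-1` Y = \bigcup_m (if unpickle m is Some z then
   if `[< Y (f (pt k z)) >] then cell z else set0 else set0)).
  apply: bigcupT_measurable => m; case: unpickle => // z.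
  by case: ifP => _ //; exact: measurable_box.
apply/seteqP; split => x /=.
  move=> Yx; exists (pickle (rd k x)) => //; rewrite pickleK.
  by case: asboolP => // _; exact/cellP.
move=> [m _]; case: unpickle => // z; case: asboolP => // Yz /cellP xz.
by rewrite xz.
Qed.

End borel.

(** * Continuously differentiable functions *)

Section C1_real.
Context {R : realType}.
Implicit Types (f g : R -> R).

(** The derivative is a witness, so that closure properties only have to
    combine instances of [is_derive]. *)
Definition C1r f := exists2 df : R -> R,
  continuous df & forall t : R, is_derive t 1 f (df t).

Lemma C1r_continuous f : C1r f -> continuous f.
Proof.
move=> [df _ fdf] t; apply: differentiable_continuous.
by apply/derivable1_diffP; have [] := fdf t.
Qed.

Lemma C1r_cst k : C1r (fun=> k).
Proof.
by exists (fun=> 0) => [|t]; [exact: cst_continuous|exact: is_derive_cst].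
Qed.

Lemma C1r_id : C1r (fun t => t).
Proof.
by exists (fun=> 1) => [|t]; [exact: cst_continuous|exact: is_derive_id].
Qed.

Lemma C1rD f g : C1r f -> C1r g -> C1r (fun t => f t + g t).
Proof.
move=> [df cdf fdf] [dg cdg gdg]; exists (fun t => df t + dg t).
  by move=> t; apply: cvgD; [exact: cdf|exact: cdg].
by move=> t; exact: (is_deriveD (fdf t) (gdg t)).
Qed.

Lemma C1rM f g : C1r f -> C1r g -> C1r (fun t => f t * g t).
Proof.
move=> Cf Cg; have cf := C1r_continuous Cf; have cg := C1r_continuous Cg.
move: Cf Cg => [df cdf fdf] [dg cdg gdg].
exists (fun t => f t * dg t + g t * df t).
  move=> t; apply: cvgD; apply: cvgM;
    [exact: cf|exact: cdg|exact: cg|exact: cdf].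
by move=> t; exact: (is_deriveM (fdf t) (gdg t)).
Qed.

Lemma C1r_comp f g : C1r f -> C1r g -> C1r (fun t => f (g t)).
Proof.
move=> [df cdf fdf] Cg; have cg := C1r_continuous Cg.
move: Cg => [dg cdg gdg]; exists (fun t => df (g t) * dg t).
  by move=> t; apply: cvgM; [exact: (continuous_comp (cg t)
    (cdf _))|exact: cdg].
by move=> t; have := @is_derive1_comp R f g t _ _ (fdf (g t)) (gdg t).
Qed.

(** For functions glued from two polynomials, whose derivative at the
    junction is not given by the rules of calculus. *)
Lemma is_derive_quadratic_remainder f (x a : R) :
  (forall h, `|f (h + x) - f x - h * a| <= h ^+ 2) -> is_derive x 1 f a.
Proof.
move=> H.
suff cv : (fun h => h^-1 *: ((f \o shift x) (h *: 1) - f x)) h @[h --> 0^']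
  --> a.
  by split; [apply/cvg_ex; exists a|exact: cvg_lim cv].
apply/cvgrPdist_le => e e0; near=> h.
have h0 : h != 0 by near: h; exact: nbhs_dnbhs_neq.
have he : `|h| <= e.
  near: h; apply: dnbhs0_le => //.
rewrite /= /shift [_%:A]mulr1 distrC.
have -> : h^-1 *: (f (h + x) - f x) - a = h^-1 * (f (h + x) - f x - h * a).
  by rewrite mulrBr mulKf.
rewrite normrM normfV ler_pdivrMl ?normr_gt0//.
apply: (le_trans (H h)); rewrite -real_normK ?num_real// expr2.
by rewrite ler_wpM2l.
Unshelve. all: by end_near. Qed.

(** All the cutoff functions below are composites of this one with
    polynomials. *)
Definition pospart2 (t : R) := Num.max t 0 ^+ 2.

Lemma C1r_pospart2 : C1r pospart2.
Proof.
exists (fun t => 2 * Num.max t 0).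
  move=> t; apply: cvgM; first exact: cvg_cst.
  by apply: (@continuous_max _ _ (fun s : R => s) (fun=> 0) t);
    [exact: cvg_id|exact: cvg_cst].
move=> t; apply: is_derive_quadratic_remainder => h.
rewrite /pospart2 ler_norml.
have [ht|ht] := leP 0 (h + t); have [t0|t0] := leP 0 t; apply/andP; split; nra.
Qed.

End C1_real.

Section C1_scalar.
Context {R : realType} {n : nat}.
Local Notation Rn := 'rV[R]_n.
Implicit Types f g : Rn -> R.

Definition C1s f := (forall x, differentiable f x) /\ forall v,
  continuous ('D_v f).

Lemma C1s_continuous f : C1s f -> continuous f.
Proof. by move=> [df _] x; exact: differentiable_continuous. Qed.

Lemma C1s_cst k : C1s (fun=> k).
Proof.
split=> [x|v]; first exact: differentiable_cst.
rewrite (_ : 'D_v _ = cst 0); first exact: cst_continuous.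
by apply/funext => x; exact: derive_cst.
Qed.

Lemma deriveC1sD f g v x : C1s f -> C1s g ->
  'D_v (fun y => f y + g y) x = 'D_v f x + 'D_v g x.
Proof.
by move=> [df _] [dg _]; exact: (deriveD (diff_derivable (df x))
  (diff_derivable (dg x))).
Qed.

Lemma C1sD f g : C1s f -> C1s g -> C1s (fun x => f x + g x).
Proof.
move=> Cf Cg; split=> [x|v x].
  by apply: differentiableD; [case: Cf|case: Cg].
rewrite (_ : 'D_v _ = fun x => 'D_v f x + 'D_v g x).
  by case: Cf Cg => _ cf [_ cg]; exact: (continuousD (cf v x) (cg v x)).
by apply/funext => y; exact: deriveC1sD.
Qed.

Lemma deriveC1sM f g v x : C1s f -> C1s g ->
  'D_v (fun y => f y * g y) x = f x * 'D_v g x + g x * 'D_v f x.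
Proof.
by move=> [df _] [dg _]; exact: (deriveM (diff_derivable (df x))
  (diff_derivable (dg x))).
Qed.

Lemma C1sM f g : C1s f -> C1s g -> C1s (fun x => f x * g x).
Proof.
move=> Cf Cg; split=> [x|v x].
  by apply: differentiableM; [case: Cf|case: Cg].
rewrite (_ : 'D_v _ = fun x => f x * 'D_v g x + g x * 'D_v f x).
  have cf := C1s_continuous Cf; have cg := C1s_continuous Cg.
  case: Cf Cg => _ cdf [_ cdg].
  exact: (continuousD (continuousM (cf x) (cdg v x)) (continuousM (cg x)
    (cdf v x))).
by apply/funext => y; exact: deriveC1sM.
Qed.

Lemma deriveC1sZ k f v x : C1s f -> 'D_v (fun y => k * f y) x = k * 'D_v f x.
Proof.
move=> Cf; rewrite (deriveC1sM v x (C1s_cst k) Cf).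
by rewrite (derive_cst k) mulr0 addr0.
Qed.

Lemma C1sZ k f : C1s f -> C1s (fun x => k * f x).
Proof. exact: (C1sM (C1s_cst k)). Qed.

Lemma C1s_prod (I : Type) (s : seq I) (P : pred I) (F : I -> Rn -> R) :
  (forall i, C1s (F i)) -> C1s (fun x => \prod_(i <- s | P i) F i x).
Proof.
move=> CF; elim: s => [|i s IH].
  rewrite (_ : (fun _ => _) = fun=> 1); first exact: C1s_cst.
  by apply/funext => x; rewrite big_nil.
have [Pi|nPi] := boolP (P i).
  rewrite (_ : (fun _ => _) = fun x => F i x * \prod_(j <- s | P j) F j x).
    exact: C1sM.
  by apply/funext => x; rewrite big_cons Pi.
rewrite (_ : (fun _ => _) = fun x => \prod_(j <- s | P j) F j x)//.
by apply/funext => x; rewrite big_cons (negbTE nPi).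
Qed.

Lemma derive_coord (i : 'I_n) v (x : Rn) :
  'D_v (fun y : Rn => y ord0 i) x = v ord0 i.
Proof.
have := derive_mx (@derivable_id _ Rn x v); rewrite derive_id.
by move=> /(congr1 (fun w : Rn => w ord0 i)); rewrite mxE.
Qed.

Lemma derive_comp_coord (i : 'I_n) (g : R -> R) (dg : R) v (x : Rn) :
  is_derive (x ord0 i) 1 g dg ->
  'D_v (fun y : Rn => g (y ord0 i)) x = v ord0 i * dg.
Proof.
move=> [gd gv]; have dx := @differentiable_coord _ _ _ x ord0 i.
have dgx : differentiable g (x ord0 i) by exact/derivable1_diffP.
rewrite deriveE; last exact: (differentiable_comp dx).
rewrite (@diff_comp _ _ _ _ (fun y : Rn => y ord0 i) g x dx dgx) /=.
by rewrite deriv1E// -deriveE// derive_coord derive1E gv.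
Qed.

Lemma C1s_comp_coord (i : 'I_n) (g : R -> R) : C1r g ->
  C1s (fun x : Rn => g (x ord0 i)).
Proof.
move=> [dg cdg gdg]; split=> [x|v].
  apply: (@differentiable_comp _ _ _ _ (fun y : Rn => y ord0 i) g).
    exact: differentiable_coord.
  by apply/derivable1_diffP; have [] := gdg (x ord0 i).
rewrite (_ : 'D_v _ = fun x : Rn => v ord0 i * dg (x ord0 i)).
  move=> x; apply: continuousM; first exact: cst_continuous.
  exact: (continuous_comp (@coord_continuous _ _ _ ord0 i x) (cdg _)).
by apply/funext => x; rewrite (derive_comp_coord v (gdg _)).
Qed.

Lemma derive_shift_rV (W : normedModType R) (f : Rn -> W) (w v x : Rn) :
  'D_v (fun y => f (y + w)) x = 'D_v f (x + w).
Proof.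
rewrite /derive (_ : (fun h => _) =
  fun h => h^-1 *: ((f \o shift (x + w)) (h *: v) - f (x + w)))//.
by apply/funext => h /=; rewrite addrA.
Qed.

Lemma differentiable_shift_rV (W : normedModType R) (f : Rn -> W) (w x : Rn) :
  differentiable f (x + w) -> differentiable (fun y => f (y + w)) x.
Proof.
move=> df; apply: (@differentiable_comp _ _ _ _ (fun y : Rn => y + w) f) => //.
Qed.

Lemma C1s_shift f w : C1s f -> C1s (fun x => f (x + w)).
Proof.
move=> [df cf]; split=> [x|v x].
  exact: differentiable_shift_rV.
rewrite (_ : 'D_v _ = fun x => 'D_v f (x + w)).
  apply: (@continuous_comp _ _ _ (fun y : Rn => y + w) ('D_v f));
    last exact: cf.
  by move=> y; apply: (differentiable_continuous (f := fun z : Rn => z + w)).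
by apply/funext => y; exact: derive_shift_rV.
Qed.

Lemma derive_line (f : Rn -> R) (x v : Rn) t : differentiable f (x + t *: v) ->
  is_derive t 1 (fun s => f (x + s *: v)) ('D_v f (x + t *: v)).
Proof.
move=> df.
have E : (fun h : R => h^-1 *: (((fun s =>
  f (x + s *: v)) \o shift t) (h *: 1) - f (x + t *: v))) =
   (fun h => h^-1 *: ((f \o shift (x + t *: v)) (h *: v) - f (x + t *: v))).
  apply/funext => h /=; congr (_ *: (f _ - _)).
  by rewrite [_%:A]mulr1 scalerDl addrCA.
split; last by rewrite /derive E.
by rewrite /derivable E; exact: diff_derivable.
Qed.

Lemma MVT_line f (x v : Rn) (h : R) : C1s f -> 0 < h ->
  exists2 c, 0 < c < h & f (x + h *: v) - f x = h * 'D_v f (x + c *: v).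
Proof.
move=> Cf h0; have [df _] := Cf.
have [||c] := @MVT R (fun s => f (x + s *: v)) (fun s =>
  'D_v f (x + s *: v)) 0 h h0.
- by move=> t _; exact: derive_line.
- apply: continuous_subspaceT => t; apply: differentiable_continuous.
  by apply/derivable1_diffP; have [] := derive_line (df (x + t *: v)).
- rewrite in_itv/= => ch; rewrite scale0r addr0 subr0 => E; exists c => //.
  by rewrite E mulrC.
Qed.

End C1_scalar.

(** * Sums of products of functions of one coordinate *)

Section compact_primitive.
Context {R : realType}.

Definition C1rc (g : R -> R) :=
  C1r g /\ exists M : R, forall t, M <= `|t| -> g t = 0.

(** Compact support makes the integral from [-oo] an antiderivative on the
    whole line. *)
Lemma C1rc_primitive g : C1rc g ->
  exists2 F : R -> R, C1r F & forall t : R, is_derive t 1 F (g t).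
Proof.
move=> [Cg [M gM]]; have cg := C1r_continuous Cg.
have ig : (@lebesgue_measure R).-integrable setT (EFin \o g).
  rewrite (_ : _ \o _ = (EFin \o g) \_ `[- `|M|, `|M|]).
    rewrite -integrable_mkcond//.
    apply: continuous_compact_integrable; first exact: segment_compact.
    exact: continuous_subspaceT.
  apply/funext => t; rewrite patchE; case: ifPn => //.
  rewrite notin_setE /= in_itv/= -ler_norml => /negP; rewrite -ltNge => Mt.
  by rewrite /= gM// (le_trans (ler_norm M))// ltW.
pose F x := (\int[@lebesgue_measure R]_(t in [set` `]-oo, x]]) g t)%R.
have FP (t : R) : is_derive t 1 F (g t).
  have [] := @continuous_FTC1 R g -oo%O t (t + 1).
  - by rewrite ltrDl.
  - exact: integrableS ig.
  - by rewrite ltNyr.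
  - exact: cg.
  move=> d1 d2; apply: DeriveDef; first exact: d1.
  by rewrite -derive1E; exact: d2.
by exists F => //; exists g.
Qed.

End compact_primitive.

Section tensor.
Context {R : realType} {n : nat}.
Local Notation Rn := 'rV[R]_n.
Local Notation e_ i := (delta_mx ord0 i : Rn).

(** These functions form an algebra large enough to approximate indicators,
    and those with compactly supported factors have an antiderivative in each
    coordinate direction that is again [C1s]. The vector fields that test the
    perimeter are thus obtained without differentiating under an integral
    sign. *)
Inductive tensor_sum (P : set (R -> R)) : (Rn -> R) -> Prop :=
| tensor_sum0 : tensor_sum P (fun=> 0)
| tensor_sumS (g : 'I_n -> R -> R) f : (forall i, P (g i)) ->
    tensor_sum P f ->
    tensor_sum P (fun x : Rn => \prod_i g i (x ord0 i) + f x).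

Lemma tensor_sum_prod (P : set (R -> R)) (g : 'I_n -> R -> R) :
  (forall i, P (g i)) -> tensor_sum P (fun x : Rn => \prod_i g i (x ord0 i)).
Proof.
move=> Pg; rewrite (_ : (fun _ => _) = fun x : Rn =>
  \prod_i g i (x ord0 i) + 0).
  by apply: tensor_sumS => //; exact: tensor_sum0.
by apply/funext => x; rewrite addr0.
Qed.

Lemma tensor_sumD P f g : tensor_sum P f -> tensor_sum P g ->
  tensor_sum P (fun x => f x + g x).
Proof.
move=> Tf Tg; elim: Tf => [|h {}f Ph Tf IH].
  by rewrite (_ : (fun _ => _) = g)//; apply/funext => x; rewrite add0r.
rewrite (_ : (fun _ => _) = fun x : Rn => \prod_i h i (x ord0 i) + (f x + g x)).
  exact: tensor_sumS.
by apply/funext => x; rewrite addrA.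
Qed.

(** Multiplication of the [i]-th factors by [h i], which may improve the
    class of the factors from [P] to [Q]; cutting off is the case of
    interest. *)
Lemma tensor_sum_prodM (P Q : set (R -> R)) (h : 'I_n -> R -> R) f :
  (forall g i, P g -> Q (fun t => h i t * g t)) ->
  tensor_sum P f -> tensor_sum Q (fun x : Rn => \prod_i h i (x ord0 i) * f x).
Proof.
move=> hPQ; elim=> [|g {}f Pg Tf IH].
  rewrite (_ : (fun _ => _) = fun=> 0); first exact: tensor_sum0.
  by apply/funext => x; rewrite mulr0.
rewrite (_ : (fun _ => _) = fun x : Rn =>
  \prod_i (h i (x ord0 i) * g i (x ord0 i)) +
    \prod_i h i (x ord0 i) * f x).
  by apply: (@tensor_sumS _ (fun i t => h i t * g i t)) => // i; exact: hPQ.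
by apply/funext => x; rewrite mulrDr big_split.
Qed.

Lemma tensor_sumM f g : tensor_sum C1r f -> tensor_sum C1r g ->
  tensor_sum C1r (fun x => f x * g x).
Proof.
move=> Tf Tg; elim: Tf => [|h {}f Ph Tf IH].
  rewrite (_ : (fun _ => _) = fun=> 0); first exact: tensor_sum0.
  by apply/funext => x; rewrite mul0r.
rewrite (_ : (fun _ => _) = fun x : Rn =>
  \prod_i h i (x ord0 i) * g x + f x * g x).
  apply: tensor_sumD => //; apply: tensor_sum_prodM Tg => k i Ck.
  exact: C1rM.
by apply/funext => x; rewrite mulrDl.
Qed.

Lemma tensor_sum_C1s f : tensor_sum C1r f -> C1s f.
Proof.
elim=> [|g {}f Pg Tf IH]; first exact: C1s_cst.
by apply: C1sD => //; apply: C1s_prod => i; exact: C1s_comp_coord.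
Qed.

Lemma sub_tensor_sum (P Q : set (R -> R)) : P `<=` Q ->
  forall f, tensor_sum P f -> tensor_sum Q f.
Proof.
move=> PQ f; elim=> [|g {}f Pg Tf IH]; first exact: tensor_sum0.
by apply: tensor_sumS => // i; exact: PQ.
Qed.

(** A pointwise form of compactness of the support that differences of
    translates inherit at once. *)
Lemma tensor_sum_support f : tensor_sum C1rc f ->
  exists M, forall x, f x != 0 -> forall i, `|x ord0 i| <= M.
Proof.
elim=> [|g {}f Pg Tf [M Mf]]; first by exists 0 => x; rewrite eqxx.
have gM i := (Pg i).2; pose N i := projT1 (cid (gM i)).
have NP i := projT2 (cid (gM i)).
exists (`|M| + \sum_i `|N i|) => x fx i.
have s0 : 0 <= \sum_i `|N i| by apply: sumr_ge0.
have [fx0|fx0] := eqVneq (f x) 0; last first.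
  apply: (le_trans (Mf x fx0 i)); rewrite -[leLHS]addr0 lerD//.
  exact: ler_norm.
move: fx; rewrite fx0 addr0 => /prodf_neq0 gx.
have : `|x ord0 i| <= N i.
  rewrite leNgt; apply/negP => /ltW Nx; have /negP := gx i isT; apply.
  by apply/eqP; exact: (NP i).
move/le_trans; apply; apply: (le_trans (ler_norm _)).
rewrite (bigD1 i)//= addrCA lerDl addr_ge0// sumr_ge0//.
Qed.

Lemma derive_constant_direction (f : Rn -> R) (v x : Rn) :
  (forall h, f (h *: v + x) = f x) -> 'D_v f x = 0.
Proof.
move=> fv; rewrite /derive (_ : (fun _ => _) = cst 0); first exact: lim_cst.
by apply/funext => h /=; rewrite fv subrr scaler0.
Qed.

(** In each product only the factor that depends on the coordinate [i] has to
    be integrated. *)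
Lemma tensor_sum_primitive (i : 'I_n) f : tensor_sum C1rc f ->
  exists2 G, C1s G & forall x, 'D_(e_ i) G x = f x.
Proof.
elim=> [|g {}f Pg Tf [G CG GP]].
  by exists (fun=> 0) => [|x]; [exact: C1s_cst|exact: derive_cst].
have [F CF FP] := C1rc_primitive (Pg i).
pose q x := \prod_(j | j != i) g j ((x : Rn) ord0 j).
have Cq : C1s q by apply: C1s_prod => j; apply: C1s_comp_coord; exact: (Pg j).1.
have CFi : C1s (fun x : Rn => F (x ord0 i)) by exact: C1s_comp_coord.
exists (fun x : Rn => F (x ord0 i) * q x + G x); first by apply: C1sD => //;
  exact: C1sM.
move=> x; rewrite deriveC1sD//; last exact: C1sM.
rewrite deriveC1sM// GP; congr (_ + _).
rewrite (derive_comp_coord _ (FP _)) mxE !eqxx mul1r.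
rewrite (_ : 'D_(e_ i) q x = 0) ?mulr0 ?add0r.
  by rewrite [RHS](bigD1 i)//= mulrC.
apply: derive_constant_direction => h; apply: eq_bigr => j ji.
by rewrite !mxE eqxx (negbTE ji)/= mulr0 add0r.
Qed.

Lemma tensor_sum_cst (i0 : 'I_n) k : tensor_sum C1r (fun=> k).
Proof.
rewrite (_ : (fun _ => _) = fun x : Rn =>
    \prod_i (fun t : R => if i == i0 then k else 1) (x ord0 i)).
  apply: (@tensor_sum_prod _ (fun i _ => if i == i0 then k else 1)) => i.
  exact: C1r_cst.
apply/funext => x; rewrite (bigD1 i0)//= eqxx big1 ?mulr1// => j.
by move/negbTE => ->.
Qed.

Lemma tensor_sum_coord (i0 : 'I_n) (g : R -> R) : C1r g ->
  tensor_sum C1r (fun x : Rn => g (x ord0 i0)).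
Proof.
move=> Cg; rewrite (_ : (fun _ => _) = fun x : Rn =>
    \prod_i (fun t => if i == i0 then g t else 1) (x ord0 i)).
  apply: (@tensor_sum_prod _ (fun i t => if i == i0 then g t else 1)) => i.
  by case: eqP => _ //; exact: C1r_cst.
apply/funext => x; rewrite (bigD1 i0)//= eqxx big1 ?mulr1// => j.
by move/negbTE => ->.
Qed.

End tensor.

Section field.
Context {R : realType} {n : nat}.
Local Notation Rn := 'rV[R]_n.
Local Notation e_ i := (delta_mx ord0 i : Rn).

Lemma derive_field (f : Rn -> R) (i : 'I_n) (v x : Rn) : differentiable f x ->
  'D_v (fun y => f y *: e_ i) x = 'D_v f x *: e_ i.
Proof.
move=> df; rewrite deriveE; last exact: differentiableZl.
by rewrite diffZl//= -deriveE.
Qed.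

Lemma C1_field (f : Rn -> R) (i : 'I_n) : C1s f -> C1 (fun x => f x *: e_ i).
Proof.
move=> [df cf]; split=> [x|v]; first exact: differentiableZl.
rewrite (_ : 'D_v _ = fun x => 'D_v f x *: e_ i).
  move=> x; apply: (@continuous_comp _ _ _ ('D_v f) (fun k => k *: e_ i)).
    exact: cf.
  exact: scalel_continuous.
by apply/funext => x; exact: derive_field.
Qed.

Lemma div_field_coord (f : Rn -> R) (i : 'I_n) x : C1s f ->
  div_field (fun y => f y *: e_ i) x = 'D_(e_ i) f x.
Proof.
move=> [df _]; rewrite /div_field (bigD1 i)//= big1 ?addr0.
  by rewrite derive_field// !mxE !eqxx mulr1.
by move=> j ji; rewrite derive_field// !mxE eqxx (negbTE ji) mulr0.
Qed.

Lemma enorm_delta (c : R) (i : 'I_n) : enorm (c *: e_ i) = `|c|.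
Proof.
rewrite /enorm (bigD1 i)//= big1 ?addr0.
  by rewrite !mxE !eqxx mulr1 sqrtr_sqr.
by move=> j ji; rewrite !mxE eqxx (negbTE ji) mulr0 expr0n.
Qed.

Lemma compactly_supported_box (phi : Rn -> Rn) (M : R) :
  (forall x, phi x != 0 -> forall i, `|x ord0 i| <= M) ->
  compactly_supported phi.
Proof.
move=> phiM; pose B := [set v : Rn | forall i, `[- M, M]%classic (v ord0 i)].
have cB : compact B by apply: (@rV_compact _ _ (fun=> `[- M, M]%classic)) => i;
  exact: segment_compact.
apply: (subclosed_compact (@closed_closure _ _) cB).
have clB : closed B by apply: compact_closed => //; exact: norm_hausdorff.
rewrite [X in _ `<=` X]((closure_id _).1 clB);
  apply: closureS => x /= /phiM Mx i.
by rewrite /= in_itv/= -ler_norml.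
Qed.

End field.

(** * Approximation of indicators by smooth functions *)

Section step_functions.
Context {R : realType}.

(** Vanishes for [t <= a]; for [t > a] it equals [1] as soon as [k * (t - a)
    ^ 2 >= 1]. *)
Definition step_approx (a : R) (k : nat) (t : R) : R :=
  1 - pospart2 (1 - k%:R * pospart2 (t - a)).

(** Equal to [(1 - (t / k.+1) ^ 2) ^ 2] on [[- k.+1, k.+1]] and to [0]
    elsewhere. *)
Definition cutoff (k : nat) (t : R) : R := pospart2 (1 - (t / k.+1%:R) ^+ 2).

Lemma C1rB f g : @C1r R f -> C1r g -> C1r (fun t => f t - g t).
Proof.
move=> Cf Cg; rewrite (_ : (fun _ => _) = fun t => f t + (-1) * g t).
  by apply: C1rD => //; apply: C1rM => //; exact: C1r_cst.
by apply/funext => t; rewrite mulN1r.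
Qed.

Lemma C1r_step_approx a k : C1r (step_approx a k).
Proof.
apply: C1rB; first exact: C1r_cst.
apply: (C1r_comp C1r_pospart2); apply: C1rB; first exact: C1r_cst.
apply: C1rM; first exact: C1r_cst.
apply: (C1r_comp C1r_pospart2); apply: C1rB; [exact: C1r_id|exact: C1r_cst].
Qed.

Lemma pospart2_ge0 (t : R) : 0 <= pospart2 t. Proof. exact: sqr_ge0. Qed.

Lemma pospart2_le1 (t : R) : t <= 1 -> pospart2 t <= 1.
Proof.
by move=> t1; rewrite /pospart2 expr_le1// ?le_max ?lexx ?orbT// ge_max t1 ler01.
Qed.

Lemma step_approx_itv a k t : 0 <= step_approx a k t <= 1.
Proof.
rewrite /step_approx subr_ge0 gerBl pospart2_ge0 andbT pospart2_le1//.
by rewrite gerBl mulr_ge0// pospart2_ge0.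
Qed.

Lemma cvg_step_approx (a t : R) :
  step_approx a k t @[k --> \oo] --> ((t \in `]a, +oo[)%:R : R).
Proof.
rewrite in_itv/= andbT; have [ta|ta] := ltP a t; last first.
  rewrite (_ : (fun k => _) = fun=> 0); first exact: cvg_cst.
  apply/funext => k; rewrite /step_approx {2}/pospart2 max_r ?subr_le0//.
  by rewrite expr0n mulr0 subr0 /pospart2 max_l// expr1n subrr.
have p0 : 0 < pospart2 (t - a)
  by rewrite /pospart2 max_l ?exprn_gt0 ?subr_ge0 ?ltW// subr_gt0.
apply: cvg_near_cst; exists (Num.trunc (pospart2 (t - a))^-1).+1 => // k /= kN.
rewrite /step_approx {1}/pospart2 max_r ?expr0n ?subr0//.
rewrite subr_le0 -ler_pdivrMr// div1r.
apply: ltW; apply: lt_le_trans (truncnS_gt _) _.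
by rewrite ler_nat.
Qed.

Lemma C1rc_cutoff k : C1rc (cutoff k).
Proof.
split.
  apply: (C1r_comp C1r_pospart2); apply: C1rB; first exact: C1r_cst.
  have Cd : @C1r R (fun t => t / k.+1%:R) by apply: C1rM;
    [exact: C1r_id|exact: C1r_cst].
  rewrite (_ : (fun _ => _) = fun t => (t / k.+1%:R) * (t / k.+1%:R));
    first exact: C1rM.
  by apply/funext => t; rewrite expr2.
exists k.+1%:R => t kt; rewrite /cutoff /pospart2 max_r ?expr0n//.
rewrite subr_le0 -real_normK ?num_real// normrM normfV.
by rewrite expr_ge1// ?divr_ge0// (ger0_norm (x := _%:R))// ler_pdivlMr// mul1r.
Qed.

Lemma cutoff_itv k t : 0 <= cutoff k t <= 1.
Proof. by rewrite /cutoff pospart2_ge0 pospart2_le1// gerBl sqr_ge0. Qed.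

Lemma cvg_cutoff t : cutoff k t @[k --> \oo] --> (1 : R).
Proof.
have c1 : {for 1 - t * 0 * (t * 0), continuous (@pospart2 R)}.
  exact: (C1r_continuous (@C1r_pospart2 R)).
have E : pospart2 (1 - t * 0 * (t * 0)) = 1 :> R.
  by rewrite !mulr0 subr0 /pospart2 max_l// expr1n.
have H : t / k.+1%:R @[k --> \oo] --> t * 0.
  by apply: cvgM; [exact: cvg_cst|exact: cvg_harmonic].
have H2 : 1 - (t / k.+1%:R) ^+ 2 @[k --> \oo] --> 1 - t * 0 * (t * 0).
  under eq_fun do rewrite expr2.
  by apply: cvgB; [exact: cvg_cst|exact: cvgM].
by have := cvg_comp _ _ H2 c1; rewrite E.
Qed.

End step_functions.

Lemma cvge0_exists_le {R : realType} (f : nat -> \bar R) (e : R) :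
  f k @[k --> \oo] --> 0%E -> 0 < e -> exists k, (f k <= e%:E)%E.
Proof.
move=> /fine_cvgP[[N1 _ H1] /cvgrPdist_le /(_ e)] + e0 => /(_ e0)[N2 _ H2].
exists (maxn N1 N2); have f1 := H1 _ (leq_maxl N1 N2).
have := H2 _ (leq_maxr N1 N2); rewrite /= sub0r normrN => f2.
by rewrite -[f _]fineK// lee_fin (le_trans _ f2)// ler_norm.
Qed.

Section density.
Context {R : realType} {n : nat}.
Local Notation Rn := 'rV[R]_n.
Local Notation mu := (@borel_lebesgue R n).
Variable S : set Rn.
Hypothesis mS : measurable S.
Hypothesis Soo : (mu S < +oo)%E.

Definition unit_bounded (u : Rn -> R) := forall x, 0 <= u x <= 1.

(** Approximation in L1 on [S] by functions with values in [[0, 1]]. The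
    bound on the values makes limits dominated and, later, the test fields
    admissible. *)
Definition tensor_approximable (P : set (R -> R)) (u : Rn -> R) :=
  forall e : R, 0 < e -> exists psi : Rn -> R, [/\ tensor_sum P psi,
    unit_bounded psi &
    (\int[mu]_(x in S) (`|psi x - u x|)%:E <= e%:E)%E].

Lemma tensor_sum_measurable (psi : Rn -> R) : tensor_sum C1r psi ->
  measurable_fun setT psi.
Proof.
move=> /tensor_sum_C1s/C1s_continuous; exact: continuous_measurable_rV.
Qed.

Lemma measurable_dist (u v : Rn -> R) (D : set Rn) :
  measurable_fun setT u -> measurable_fun setT v ->
  measurable_fun D (fun x => (`|u x - v x|)%:E).
Proof.
move=> mu' mv; apply: measurable_funTS; apply/measurable_EFinP.
by apply: measurableT_comp => //; exact: measurable_funB.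
Qed.

Lemma integral_dist_triangle (u v w : Rn -> R) :
  measurable_fun setT u -> measurable_fun setT v -> measurable_fun setT w ->
  (\int[mu]_(x in S) (`|u x - w x|)%:E <=
   \int[mu]_(x in S) (`|u x - v x|)%:E + \int[mu]_(x in S) (`|v x - w x|)%:E)%E.
Proof.
move=> m1 m2 m3; rewrite -ge0_integralD//; [|exact: measurable_dist..].
apply: ge0_le_integral => //.
- exact: measurable_dist.
- by apply: emeasurable_funD; exact: measurable_dist.
- by move=> x _; rewrite -EFinD lee_fin -(subrKA (v x)) ler_normD.
Qed.

Lemma cvg_integral_dist (u_ : (Rn -> R)^nat) (u : Rn -> R) :
  (forall k, measurable_fun setT (u_ k)) ->
  (forall k, unit_bounded (u_ k)) -> unit_bounded u ->
  (forall x, u_ k x @[k --> \oo] --> u x) ->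
  (\int[mu]_(x in S) (`|u_ k x - u x|)%:E)%E @[k --> \oo] --> 0%E.
Proof.
move=> mu_ b_ b cu.
have mu' : measurable_fun setT u by apply: measurable_fun_cvg mu_ _ => x _;
  exact: cu.
have [|||||_ H _] := @dominated_convergence _ _ _ mu S mS
  (fun k => EFin \o u_ k) (EFin \o u) (cst 1%E).
- by move=> k; apply/measurable_EFinP; exact: measurable_funTS.
- by apply/measurable_EFinP; exact: measurable_funTS.
- by apply: aeW => x _; apply: cvg_EFin; [exact: nearW|exact: cu].
- apply/integrableP; split; first exact: measurable_cst.
  by under eq_integral do rewrite abse1; rewrite integral_cst// mul1e.
- by apply: aeW => x k _ /=; rewrite lee_fin; have /andP[u0 u1] := b_ k x;
    rewrite ger0_norm.
exact: H.
Qed.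

(** Dominated convergence, since [S] has finite measure. *)
Lemma tensor_approximable_lim P (u_ : (Rn -> R)^nat) (u : Rn -> R) :
  P `<=` C1r ->
  (forall k, measurable_fun setT (u_ k)) ->
  (forall k, unit_bounded (u_ k)) -> unit_bounded u ->
  (forall x, u_ k x @[k --> \oo] --> u x) ->
  (forall k, tensor_approximable P (u_ k)) -> tensor_approximable P u.
Proof.
move=> PC mu_ b_ b cu ta e e0.
have mu' : measurable_fun setT u by apply: measurable_fun_cvg mu_ _ => x _;
  exact: cu.
have e20 : 0 < e / 2 by rewrite divr_gt0.
have [k kP] := cvge0_exists_le (cvg_integral_dist mu_ b_ b cu) e20.
have [psi [Tpsi bpsi psik]] := ta k _ e20; exists psi; split => //.
have mpsi := tensor_sum_measurable (sub_tensor_sum PC Tpsi).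
apply: (le_trans (integral_dist_triangle mpsi (mu_ k) mu')).
by rewrite [e]splitr EFinD leeD.
Qed.

Lemma tensor_approximable_tensor P (psi : Rn -> R) : tensor_sum P psi ->
  unit_bounded psi ->
  tensor_approximable P psi.
Proof.
move=> Tp bp e e0; exists psi; split => //.
by under eq_integral do rewrite subrr normr0; rewrite integral0 lee_fin ltW.
Qed.

Lemma tensor_approximable_setC (A : set Rn) (i0 : 'I_n) :
  tensor_approximable C1r \1_A -> tensor_approximable C1r \1_(~` A).
Proof.
move=> tA e e0; have [psi [Tpsi bpsi psiA]] := tA e e0.
exists (fun x => 1 + -1 * psi x); split.
- apply: tensor_sumD; first exact: tensor_sum_cst.
  by apply: tensor_sumM => //; exact: tensor_sum_cst.
- by move=> x; have := bpsi x; lra.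
- apply: le_trans psiA; rewrite le_eqVlt; apply/orP; left; apply/eqP.
  apply: eq_integral => x _; congr EFin; rewrite !indicE in_setC -[LHS]normrN.
  by congr `|_|; case: (x \in A) => /=; lra.
Qed.

Lemma tensor_approximable_setU (A B : set Rn) (i0 : 'I_n) :
  measurable A -> measurable B ->
  tensor_approximable C1r \1_A -> tensor_approximable C1r \1_B ->
  tensor_approximable C1r \1_(A `|` B).
Proof.
move=> mA mB tA tB e e0; have e20 : 0 < e / 2 by rewrite divr_gt0.
have [f [Tf bf fA]] := tA _ e20; have [g [Tg bg gB]] := tB _ e20.
have mf := tensor_sum_measurable Tf; have mg := tensor_sum_measurable Tg.
have Th : tensor_sum C1r (fun x => f x + g x + -1 * (f x * g x)).
  apply: tensor_sumD; first exact: tensor_sumD.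
  by apply: tensor_sumM; [exact: tensor_sum_cst|exact: tensor_sumM].
exists (fun x => f x + g x + -1 * (f x * g x)); split => //.
- by move=> x; have /andP[f0 f1] := bf x; have /andP[g0 g1] := bg x;
    apply/andP; split; nra.
- rewrite [e]splitr EFinD; apply: le_trans (leeD fA gB).
  rewrite -ge0_integralD//; [|exact: measurable_dist..].
  apply: ge0_le_integral => //.
  + apply: measurable_dist => //; first exact: tensor_sum_measurable.
    by apply: measurable_indic; exact: measurableU.
  + by apply: emeasurable_funD; apply: measurable_dist.
  + move=> x _; rewrite -EFinD lee_fin !indicE in_setU.
    have /andP[f0 f1] := bf x; have /andP[g0 g1] := bg x.
    case: (x \in A); case: (x \in B) => /=; rewrite ?subr0.
    * rewrite !ler0_norm; nra.
    * rewrite (ger0_norm (x := g x))// !ler0_norm; nra.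
    * rewrite (ger0_norm (x := f x))// !ler0_norm; nra.
    * rewrite !ger0_norm; nra.
Qed.

Lemma unit_bounded_indic (A : set Rn) : unit_bounded \1_A.
Proof.
by move=> x; rewrite indicE; case: (_ \in _) => /=; rewrite !lexx ?ler01.
Qed.

Lemma tensor_approximable_bigcup (A : (set Rn)^nat) (i0 : 'I_n) :
  (forall k, measurable (A k)) ->
  (forall k, tensor_approximable C1r \1_(A k)) ->
  tensor_approximable C1r \1_(\bigcup_k A k).
Proof.
move=> mA tA; pose B k := \big[setU/set0]_(i < k) A i.
have mB k : measurable (B k) by exact: bigsetU_measurable.
apply: (@tensor_approximable_lim C1r (fun k => \1_(B k))) => //.
- by move=> k; exact: unit_bounded_indic.
- exact: unit_bounded_indic.
- move=> x; apply: cvg_near_cst; rewrite !indicE.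
  have [[k _ Akx]|nA] := pselect ((\bigcup_k A k) x).
    exists k.+1 => // j /= kj.
    have -> : x \in \bigcup_k A k by apply/mem_set; exists k.
    rewrite indicE; have -> // : x \in B j.
    by apply/mem_set; rewrite /B -bigcup_mkord; exists k.
  apply: nearW => k.
  have -> : (x \in \bigcup_k A k) = false by apply/memNset.
  rewrite indicE; have -> // : (x \in B k) = false.
  apply/memNset; rewrite /B -bigcup_mkord => -[j _ Ajx].
  by apply: nA; exists j.
- elim=> [|k IH].
    rewrite /B big_ord0; move=> e e0; exists (fun=> 0); split.
    + exact: tensor_sum0.
    + by move=> x; rewrite lexx ler01.
    + by under eq_integral do rewrite indic0 subrr normr0;
        rewrite integral0 lee_fin ltW.
  rewrite /B big_ord_recr/=.
  exact: (tensor_approximable_setU i0 (mB k) (mA k) IH (tA k)).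
Qed.

Lemma tensor_approximable_ray (i : 'I_n) (a : R) :
  tensor_approximable C1r \1_[set x : Rn | `]a, +oo[%classic (x ord0 i)].
Proof.
have T k : tensor_sum C1r (fun x : Rn => step_approx a k (x ord0 i)).
  by apply: tensor_sum_coord; exact: C1r_step_approx.
have b k : unit_bounded (fun x : Rn => step_approx a k (x ord0 i)).
  by move=> x; exact: step_approx_itv.
apply: (@tensor_approximable_lim C1r (fun k x =>
  step_approx a k (x ord0 i))) => //.
- by move=> k; exact: tensor_sum_measurable.
- exact: unit_bounded_indic.
- by move=> x; rewrite indicE (_ : (x \in _) = (x ord0 i \in `]a, +oo[));
    [exact: cvg_step_approx | apply/idP/idP => [/set_mem//|h]; exact/mem_set].
- by move=> k; exact: tensor_approximable_tensor.
Qed.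

(** The sets with approximable indicators form a sigma-algebra; it contains
    the preimages of rays under the coordinates, and these generate the Borel
    sets. *)
Lemma tensor_approximable_measurable (A : set Rn) (i0 : 'I_n) :
  measurable A -> tensor_approximable C1r \1_A.
Proof.
suff H : @measurable _ Rn `<=` [set A | measurable A /\ tensor_approximable C1r \1_A].
  by move=> /H[].
have sa : sigma_algebra setT [set A : set Rn | measurable A /\ tensor_approximable C1r \1_A].
  split.
  - split => // e e0; exists (fun=> 0); split.
    + exact: tensor_sum0.
    + by move=> x; rewrite lexx ler01.
    + by under eq_integral do rewrite indic0 subrr normr0;
        rewrite integral0 lee_fin ltW.
  - move=> B [mB tB]; rewrite setTD; split; first exact: measurableC.
    exact: tensor_approximable_setC.
  - move=> B H; split; first by apply: bigcupT_measurable => k; have [] := H k.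
    by apply: tensor_approximable_bigcup => // k; have [] := H k.
apply: smallest_sub; first exact: sa.
have sub (i : 'I_n) : preimage_set_system setT (@rV_coord R n i) measurable `<=`
    [set A : set Rn | measurable A /\ tensor_approximable C1r \1_A].
  have mpre (Y : set (measurableTypeR R)) : measurable Y ->
      measurable (@rV_coord R n i @^-1` Y).
    by move=> mY; rewrite -[X in measurable X]setTI; exact: measurable_rV_coord.
  move=> _ [Y mY <-]; rewrite setTI; split; first exact: mpre.
  suff : @measurable _ (measurableTypeR R) `<=` [set Y | measurable Y /\
      tensor_approximable C1r \1_(@rV_coord R n i @^-1` Y)].
    by move=> /(_ _ mY)[].
  rewrite [X in X `<=` _]RGenOInfty.measurableE; apply: smallest_sub.
    split.
    + split => //; rewrite preimage_set0; by case: sa => -[].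
    + move=> B [mB tB]; rewrite setTD; split; first exact: measurableC.
      by rewrite preimage_setC; exact: tensor_approximable_setC.
    + move=> B H; split; first by apply: bigcupT_measurable => k;
        have [] := H k.
      rewrite preimage_bigcup; apply: tensor_approximable_bigcup => // k.
        by apply: mpre; have [] := H k.
      by have [] := H k.
  move=> _ [a ->]; split; first exact: measurable_itv.
  exact: tensor_approximable_ray.
move=> B; rewrite -bigcup_seq => -[i _]; exact: sub.
Qed.

(** Multiplication by a product of cutoffs that tend to [1] makes the
    approximants compactly supported. *)
Lemma tensor_approximable_compact (A : set Rn) (i0 : 'I_n) :
  measurable A -> tensor_approximable C1rc \1_A.
Proof.
move=> mA e e0; have e20 : 0 < e / 2 by rewrite divr_gt0.
have [psi [Tpsi bpsi psiA]] := tensor_approximable_measurable i0 mA e20.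
have mpsi := tensor_sum_measurable Tpsi.
pose chi k (x : Rn) := \prod_i cutoff k (x ord0 i) * psi x.
have Tchi k : tensor_sum C1rc (chi k).
  apply: (@tensor_sum_prodM _ _ C1r C1rc (fun=> cutoff k)) Tpsi => g i Cg;
    have [Cc [M cM]] := @C1rc_cutoff R k.
  by split; [exact: C1rM|exists M => t /cM ->; rewrite mul0r].
have bchi k : unit_bounded (chi k).
  move=> x; have /andP[p0 p1] := bpsi x.
  have c0 : 0 <= \prod_i cutoff k (x ord0 i).
    by apply: prodr_ge0 => i _; have /andP[] := cutoff_itv k (x ord0 i).
  have c1 : \prod_i cutoff k (x ord0 i) <= 1.
    by apply: prodr_ile1 => i _; exact: cutoff_itv.
  by rewrite /chi mulr_ge0// mulr_ile1.
have mchi k : measurable_fun setT (chi k).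
  by apply: tensor_sum_measurable; apply: sub_tensor_sum (Tchi k) => g [].
have cchi x : chi k x @[k --> \oo] --> psi x.
  rewrite -[X in _ --> X]mul1r; apply: cvgM; last exact: cvg_cst.
  rewrite [X in _ --> X](_ : _ = \prod_(i < n) 1); last by rewrite big1.
  apply: cvg_big => [|i _]; [exact: mul_continuous|exact: cvg_cutoff].
have [k kP] := cvge0_exists_le (cvg_integral_dist mchi bchi bpsi cchi) e20.
exists (chi k); split => //.
have mI : measurable_fun setT (\1_A : Rn -> R) by exact: measurable_indic.
apply: (le_trans (integral_dist_triangle (mchi k) mpsi mI)).
by rewrite [e]splitr EFinD leeD.
Qed.

End density.

(** * The perimeter of Borel sets *)

Section perimeter_borel.
Context {R : realType} {n : nat}.
Local Notation Rn := 'rV[R]_n.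
Local Notation mu := (@borel_lebesgue R n).
Local Notation e_ i := (delta_mx ord0 i : Rn).

Definition admissible (phi : Rn -> Rn) :=
  [/\ C1 phi, compactly_supported phi & forall x, enorm (phi x) <= 1].

Lemma continuous_div_field (phi : Rn -> Rn) : C1 phi ->
  continuous (div_field phi).
Proof.
move=> [_ cphi] x; rewrite /div_field.
apply: (@cvg_big R _ +%R 0 xpredT _ _ _ _ (fun i x => ('D_(e_ i) phi x) ord0 i)
   (fun i => ('D_(e_ i) phi x) ord0 i)).
- exact: add_continuous.
- exact: (nbhs_filter x).
move=> i _.
apply: (@continuous_comp _ _ _ ('D_(e_ i) phi) (fun M : Rn => M ord0 i)).
  exact: cphi.
exact: coord_continuous.
Qed.

Lemma measurable_div_field (phi : Rn -> Rn) : C1 phi ->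
  measurable_fun setT (fun x => (div_field phi x)%:E).
Proof.
move=> Cphi; apply/measurable_EFinP; apply: continuous_measurable_rV.
exact: continuous_div_field.
Qed.

Lemma integral_div_le_perimeter (E : set Rn) phi : measurable E ->
  admissible phi -> (\int[mu]_(x in E) (div_field phi x)%:E <= perimeter E)%E.
Proof.
move=> mE aphi; apply: ereal_sup_ubound; exists phi => //.
apply: integral_lebesgue_rV => //; first exact: borel_lebesgue_measurable.
  by rewrite setDv measure0.
by apply: measurable_div_field; case: aphi.
Qed.

Lemma perimeter_le (E : set Rn) (c : \bar R) : measurable E ->
  (forall phi, admissible phi ->
    (\int[mu]_(x in E) (div_field phi x)%:E <= c)%E) ->
  (perimeter E <= c)%E.
Proof.
move=> mE H; apply: ge_ereal_sup => _ [phi aphi <-].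
apply: le_trans (H phi aphi); rewrite le_eqVlt; apply/orP; left; apply/eqP.
apply: integral_lebesgue_rV => //; first exact: borel_lebesgue_measurable.
  by rewrite setDv measure0.
by apply: measurable_div_field; case: aphi.
Qed.

Lemma perimeter_ge0 (E : set Rn) : (0 <= perimeter E)%E.
Proof.
apply: ereal_sup_ubound; exists (fun=> 0).
  split.
  - split=> [x|v]; first exact: differentiable_cst.
    rewrite (_ : 'D_v _ = cst 0); first exact: cst_continuous.
    by apply/funext => x; exact: derive_cst.
  - by apply: (@compactly_supported_box _ _ _ 0) => x; rewrite eqxx.
  - by move=> x; rewrite /enorm big1 ?sqrtr0// => i _; rewrite mxE expr0n.
rewrite (eq_integral (fun=> 0%E)) ?integral0// => x _.
rewrite /div_field big1// => i _.
by rewrite (_ : 'D_(e_ i) _ x = 0) ?mxE//; exact: derive_cst.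
Qed.

Lemma bounded_integrable (E : set Rn) (f : Rn -> R) (c : R) :
  measurable E -> (mu E < +oo)%E -> measurable_fun setT f ->
  (forall x, `|f x| <= c) -> mu.-integrable E (EFin \o f).
Proof.
move=> mE Eoo mf fc; apply: measurable_bounded_integrable => //.
  exact: measurable_funTS.
exists c; split; first exact: num_real.
by move=> M cM x _ /=; rewrite (le_trans (fc x))// ltW.
Qed.

Lemma measurable_preimage_add (v : Rn) (A : set Rn) : measurable A ->
  measurable ((fun x : Rn => x + v) @^-1` A).
Proof.
by move=> mA; rewrite -[X in measurable X]setTI; exact: measurable_rV_add.
Qed.

(** The difference of a test function and its translate by [h] in the
    direction [e_ i] is [h] times the divergence of an admissible field, namely
    the mean of the test function over the segment, carried by [e_ i]. *)
Lemma integral_tensor_shift_le (E : set Rn) (i : 'I_n) (h : R) psi :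
  measurable E -> (mu E < +oo)%E -> 0 < h ->
  tensor_sum C1rc psi -> unit_bounded psi ->
  (\int[mu]_(x in E) (psi x)%:E <=
   h%:E * perimeter E +
     \int[mu]_(x in (fun x : Rn => x + h *: e_ i)%R @^-1` E) (psi x)%:E)%E.
Proof.
move=> mE Eoo h0 Tpsi bpsi.
have [G CG GP] := tensor_sum_primitive i Tpsi.
have [M MP] := tensor_sum_support Tpsi.
have Cpsi : C1s psi by apply: tensor_sum_C1s;
  apply: sub_tensor_sum Tpsi => g [].
have mpsi : measurable_fun setT psi.
  by apply: continuous_measurable_rV; exact: C1s_continuous.
pose w := - (h *: e_ i).
pose F x := h^-1 * (G x + -1 * G (x + w)).
have CGw := C1s_shift w CG.
have CNGw := C1sZ (-1) CGw.
have CD := C1sD CG CNGw.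
have CF : C1s F := C1sZ h^-1 CD.
have dF x : 'D_(e_ i) F x = h^-1 * (psi x - psi (x + w)).
  rewrite (deriveC1sZ _ _ _ CD) (deriveC1sD _ _ CG CNGw) (deriveC1sZ _ _ _ CGw).
  by rewrite derive_shift_rV !GP mulN1r.
(* By the mean value theorem [F x] is a value of [psi] on the segment from
   [x + w] to [x]; this bounds [F] and its support. *)
have Fpsi x : exists2 c : R, 0 < c < h & F x = psi (x + w + c *: e_ i).
  have [c ch E1] := MVT_line (x + w) (e_ i) CG h0; exists c => //.
  move: E1; rewrite GP {1}/w subrK => E1.
  by rewrite /F mulN1r E1 mulKf// gt_eqF.
have aF : admissible (fun x => F x *: e_ i).
  split; first exact: C1_field.
  - apply: (@compactly_supported_box _ _ _ (M + h)) => x Fx j.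
    have : F x != 0 by apply: contraNneq Fx => ->; rewrite scale0r.
    have [c /andP[c0 ch] ->] := Fpsi x; move=> /MP /(_ j).
    rewrite /w !mxE eqxx/=.
    case: (j == i); rewrite ?mulr1 ?mulr0 ?oppr0 ?addr0; rewrite !ler_norml;
      lra.
  - move=> x; rewrite enorm_delta; have [c _ ->] := Fpsi x.
    by have /andP[p0 p1] := bpsi (x + w + c *: e_ i); rewrite ger0_norm.
have := integral_div_le_perimeter mE aF.
under eq_integral do rewrite div_field_coord// dF.
have nb x : `|psi x| <= 1 by have /andP[p0 p1] := bpsi x; rewrite ger0_norm.
have mpw : measurable_fun setT (fun x : Rn => psi (x + w)).
  by apply: (measurableT_comp mpsi); exact: measurable_rV_add.
have ip := bounded_integrable mE Eoo mpsi nb.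
have ipw := bounded_integrable mE Eoo mpw (fun x => nb (x + w)).
under eq_integral do rewrite EFinM EFinB.
rewrite integralZl//; last exact: integrableB.
rewrite integralB// => H.
have -> : (\int[mu]_(x in (fun x : Rn => x + h *: e_ i)%R @^-1` E) (psi x)%:E =
   \int[mu]_(x in E) (psi (x + w)%R)%:E)%E.
  rewrite -(@integral_shift _ _ (h *: e_ i) E (fun x : Rn =>
    (psi (x + w)%R)%:E))//.
    by apply: eq_integral => x _; rewrite /w addrK.
  exact/measurable_EFinP.
rewrite -leeBlDr; last exact: integrable_fin_num.
by rewrite -[leLHS]mul1e -(divff (lt0r_neq0 h0)) EFinM -muleA lee_pmul2l.
Qed.

End perimeter_borel.

(** * The perimeter bounds the effect of translations *)

Section translation_estimate.
Context {R : realType} {n : nat}.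
Local Notation Rn := 'rV[R]_n.
Local Notation mu := (@borel_lebesgue R n).
Local Notation e_ i := (delta_mx ord0 i : Rn).
Local Notation shift_set v E := ((fun x : Rn => x + v)%R @^-1` E).

(** The inequality of [integral_tensor_shift_le] passes to the indicator of
    [E] minus its translate: its integral over [E] is the measure to be bounded,
    while its integral over the translate vanishes. *)
Lemma measure_setD_shift_coord (E : set Rn) (i : 'I_n) (h : R) :
  measurable E -> (mu E < +oo)%E -> 0 < h ->
  (mu (E `\` shift_set (h *: e_ i) E) <= h%:E * perimeter E)%E.
Proof.
move=> mE Eoo h0; set T := shift_set _ E; set A := E `\` T.
have mT : measurable T by exact: measurable_preimage_add.
have mA : measurable A by exact: measurableD.
have Too : (mu T < +oo)%E by rewrite borel_lebesgue_shift.
have mS : measurable (E `|` T) by exact: measurableU.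
have Soo : (mu (E `|` T) < +oo)%E.
  apply: le_lt_trans (measureU2 _ mE mT) _; rewrite ?inE//.
  exact: lte_add_pinfty.
apply/lee_addgt0Pr => d d0; have d20 : 0 < d / 2 by rewrite divr_gt0.
have [psi [Tpsi bpsi psiA]] := tensor_approximable_compact mS Soo i mA d20.
have mpsi : measurable_fun setT psi.
  by apply: tensor_sum_measurable; apply: sub_tensor_sum Tpsi => g [].
have mI : measurable_fun setT (\1_A : Rn -> R) by exact: measurable_indic.
have mEpsi D : measurable_fun D (fun x => (psi x)%:E).
  by apply: measurable_funTS; exact/measurable_EFinP.
have sub D : measurable D -> D `<=` E `|` T ->
    (\int[mu]_(x in D) (`|psi x - \1_A x|)%:E <= (d / 2)%:E)%E.
  move=> mD DS; apply: le_trans psiA; apply: ge0_subset_integral => //.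
  exact: measurable_dist.
have H1 : (mu A <= \int[mu]_(x in E) (psi x)%:E + (d / 2)%:E)%E.
  apply: (@le_trans _ _ (\int[mu]_(x in E) (psi x)%:E +
     \int[mu]_(x in E) (`|psi x - \1_A x|)%:E)%E); last first.
    by rewrite leeD2l// sub//; exact: subsetUl.
  have -> : mu A = (\int[mu]_(x in E) (\1_A x)%:E)%E.
    by rewrite integral_indic// setIidl//; exact: subDsetl.
  have p0 x : (0 <= (psi x)%:E)%E by rewrite lee_fin; have /andP[] := bpsi x.
  rewrite -ge0_integralD//; last exact: measurable_dist.
  apply: ge0_le_integral => //.
  - by apply: measurable_funTS; exact/measurable_EFinP.
  - by apply: emeasurable_funD => //; exact: measurable_dist.
  - move=> x _; rewrite -EFinD lee_fin -lerBlDl distrC; exact: ler_norm.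
have H2 : (\int[mu]_(x in T) (psi x)%:E <= (d / 2)%:E)%E.
  apply: le_trans (sub T mT _); last exact: subsetUr.
  rewrite le_eqVlt; apply/orP; left; apply/eqP/eq_integral => x xT.
  rewrite indicE (_ : (x \in A) = false) ?subr0.
    by rewrite ger0_norm//; have /andP[] := bpsi x.
  by apply/memNset => -[_]; apply; exact/set_mem.
apply: (le_trans H1); rewrite [in leRHS](splitr d) EFinD addeA leeD2r//.
apply: le_trans (integral_tensor_shift_le i mE Eoo h0 Tpsi bpsi) _.
by rewrite leeD2l.
Qed.

Definition shift_defect (E : set Rn) (v : Rn) : \bar R :=
  mu (E `\` shift_set v E).

Lemma shift_defectD (E : set Rn) u v : measurable E ->
  (shift_defect E (u + v)%R <= shift_defect E u + shift_defect E v)%E.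
Proof.
move=> mE; rewrite /shift_defect.
have mu' w := measurable_preimage_add w mE.
rewrite -(@borel_lebesgue_shift _ _ u (E `\` shift_set v E));
  last exact: measurableD.
apply: le_trans (measureU2 _ _ _).
- apply: le_measure; rewrite ?inE.
  + exact: measurableD.
  + by apply: measurableU; [|apply: measurable_preimage_add];
      exact: measurableD.
  + move=> x [Ex /= nE]; have [Eu|nEu] := pselect (E (x + u)); last by left.
    by right; split => //=; rewrite -addrA.
- exact: measurableD.
- by apply: measurable_preimage_add; exact: measurableD.
Qed.

Lemma shift_defectN (E : set Rn) v : measurable E -> (mu E < +oo)%E ->
  shift_defect E (- v) = shift_defect E v.
Proof.
move=> mE Eoo; rewrite /shift_defect.
rewrite -(@borel_lebesgue_shift _ _ v (E `\` shift_set (- v) E)); last first.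
  by apply: measurableD => //; exact: measurable_preimage_add.
have -> : shift_set v (E `\` shift_set (- v) E) = shift_set v E `\` E.
  by apply/seteqP; split => x /=; rewrite addrK.
have mT := measurable_preimage_add v mE.
have ET : mu (shift_set v E) = mu E by exact: borel_lebesgue_shift.
have Too : (mu (shift_set v E) < +oo)%E by rewrite ET.
by rewrite !measureD// setIC; congr (_ - _)%E; exact: ET.
Qed.

(** Moving along the axes one after the other. A negative move is turned into
    a positive one by the invariance of the measure. *)
Lemma shift_defect_le (E : set Rn) v : measurable E -> (mu E < +oo)%E ->
  (shift_defect E v <= (\sum_i `|v ord0 i|)%:E * perimeter E)%E.
Proof.
move=> mE Eoo; have P0 := perimeter_ge0 E.
have d0 : shift_defect E 0 = 0%E.
  rewrite /shift_defect (_ : _ `\` _ = set0) ?measure0//.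
  by apply/seteqP; split => x //= []; rewrite addr0.
have dpos (h : R) i : 0 < h ->
  (shift_defect E (h *: e_ i) <= h%:E * perimeter E)%E.
  by move=> h0; exact: measure_setD_shift_coord.
have dh (h : R) i : (shift_defect E (h *: e_ i) <= `|h|%:E * perimeter E)%E.
  have [h0|h0|->] := ltgtP h 0.
  - rewrite -shift_defectN// -scaleNr ltr0_norm//.
    by apply: dpos; rewrite oppr_gt0.
  - by rewrite gtr0_norm//; exact: dpos.
  - by rewrite scale0r d0 normr0 mul0e.
rewrite {1}[v]row_sum_delta.
elim: (index_enum _) => [|i s IH]; first by rewrite !big_nil d0 mul0e.
rewrite !big_cons; apply: (le_trans (shift_defectD _ _ mE)).
by rewrite EFinD ge0_muleDl ?lee_fin ?sumr_ge0// leeD.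
Qed.

End translation_estimate.

(** * A Poincare inequality on cubes *)

Lemma sum_measure_disjoint_le {R : realType} {d} {T : measurableType d}
    (m : {measure set T -> \bar R}) (K : eqType) (s : seq K)
    (W : K -> set T) (Z : set T) :
  uniq s -> (forall k, measurable (W k)) -> measurable Z ->
  (forall k, k \in s -> W k `<=` Z) ->
  (forall k k', k != k' -> W k `&` W k' = set0) ->
  (\sum_(k <- s) m (W k) <= m Z)%E.
Proof.
move=> + mW + + tW; elim: s Z => [|k s IH] Z; first by rewrite big_nil.
rewrite big_cons /= => /andP[ks us] mZ WZ.
have -> : m Z = (m (W k) + m (Z `\` W k))%E.
  rewrite -measureU//; first by rewrite setDUK//; apply: WZ; rewrite mem_head.
  - exact: measurableD.
  - by rewrite setDIK.
rewrite leeD2l// IH//; first exact: measurableD.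
move=> j js x Wj; split; first by apply: (WZ j) => //; rewrite in_cons js orbT.
move=> Wk; have jk : j != k by apply: contraNneq ks => <-.
by rewrite -[False]/(set0 x) -(tW _ _ jk).
Qed.

Section poincare.
Context {R : realType} {n : nat}.
Local Notation Rn := 'rV[R]_n.
Local Notation mu := (@borel_lebesgue R n).
Local Notation shift_set v E := ((fun x : Rn => x + v)%R @^-1` E).

Lemma measurable_rV_addp : measurable_fun setT
  (fun p : Rn * Rn => p.1 + p.2 : Rn).
Proof.
apply: measurable_fun_rV => i.
rewrite (_ : _ \o _ = (fun p => rV_coord i p.1 + rV_coord i p.2)).
  apply: measurable_funD.
  - exact: (measurableT_comp (measurable_rV_coord i) measurable_fst).
  - exact: (measurableT_comp (measurable_rV_coord i) measurable_snd).
by apply/funext => x; rewrite /rV_coord /= !mxE.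
Qed.

Lemma measurable_pair_set (A B C : set Rn) :
  measurable A -> measurable B -> measurable C ->
  measurable [set p : Rn * Rn | [/\ A p.1, B (p.1 + p.2) & C p.2]].
Proof.
move=> mA mB mC.
rewrite (_ : mkset _ = (fst @^-1` A) `&` ((fun p : Rn * Rn =>
  p.1 + p.2) @^-1` B)
  `&` (snd @^-1` C)); last by apply/seteqP; split => p /= [] // [].
apply: measurableI; first apply: measurableI.
- by rewrite -[X in measurable X]setTI; exact: measurable_fst.
- by rewrite -[X in measurable X]setTI; exact: measurable_rV_addp.
- by rewrite -[X in measurable X]setTI; exact: measurable_snd.
Qed.

(** Substituting [y = x + h] in the second variable. *)
Lemma product_measure_pair (A B : set Rn) : measurable A -> measurable B ->
  ((mu \x mu) [set p : Rn * Rn | [/\ A p.1, B (p.1 + p.2)%R & True]] =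
   mu A * mu B)%E.
Proof.
move=> mA mB; rewrite /product_measure1.
transitivity (\int[mu]_(x in A) mu B)%E; last by rewrite integral_cst// muleC.
rewrite [RHS]integral_mkcond; apply: eq_integral => x _ /=.
rewrite patchE; case: ifPn => [|] xA.
  rewrite -(borel_lebesgue_shift x mB); congr (mu _).
  rewrite /xsection; apply/seteqP; split => y /=; rewrite inE /= addrC.
    by case.
  by move=> By; split => //; exact/set_mem.
rewrite (_ : xsection _ x = set0) ?measure0//.
apply/seteqP; split => y //=; rewrite /xsection /= inE /= => -[Ax _ _].
by move/negP: xA; apply; exact/mem_set.
Qed.

(** Integrating first in [x] with [h] fixed. *)
Lemma product_measure_defect_le (E H : set Rn) (c : \bar R) :
  measurable E -> measurable H ->
  (forall h, H h -> (shift_defect E h <= c)%E) -> (0 <= c)%E ->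
  ((mu \x mu) [set p : Rn * Rn | [/\ E p.1, (~` E) (p.1 + p.2)%R & H p.2]] <=
   c * mu H)%E.
Proof.
move=> mE mH Hc c0.
set W := [set p | _].
have mW : measurable W by apply: measurable_pair_set => //; exact: measurableC.
have -> : ((mu \x mu) W = \int[mu]_y (mu (ysection W y)))%E.
  by have := @indic_fubini_tonelli _ _ _ _ _ mu mu W mW;
    rewrite indic_fubini_tonelli_FE// indic_fubini_tonelli_GE//.
rewrite -integral_cst// [leRHS]integral_mkcond.
apply: ge0_le_integral => //.
- exact: (measurable_fun_ysection mu).
- by apply/(measurable_restrictT _ mH); exact: measurable_cst.
- move=> h _; rewrite patchE; case: ifPn => hH.
    apply: le_trans (Hc h (set_mem hH)); rewrite /shift_defect.
    apply: le_measure; rewrite ?inE.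
    + exact: measurable_ysection.
    + by apply: measurableD => //; exact: measurable_preimage_add.
    + by move=> x; rewrite /ysection /= inE /= => -[].
  rewrite (_ : ysection _ _ = set0) ?measure0//.
  apply/seteqP; split => x //=; rewrite /ysection /= inE /= => -[_ _ Hh].
  by move/negP: hH; apply; exact/mem_set.
Qed.

(** For [x] and [y] in the same cube, [y] is the translate of [x] by a vector of
    the cube of side [2 * l] around the origin. *)
Lemma poincare_cubes (K : finType) (Q : K -> set Rn) (l : R) (E : set Rn) :
  0 <= l -> (forall k, measurable (Q k)) ->
  (forall k k', k != k' -> Q k `&` Q k' = set0) ->
  (forall k x y, Q k x -> Q k y -> forall i, `|y ord0 i - x ord0 i| < l) ->
  measurable E -> (mu E < +oo)%E ->
  (\sum_k (mu (E `&` Q k) * mu (Q k `\` E)) <=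
     (n%:R * l)%:E * perimeter E * ((2 * l) ^+ n)%:E)%E.
Proof.
move=> l0 mQ tQ dQ mE Eoo.
pose H : set Rn := box (fun=> - l) (fun=> l).
have mH : measurable H by exact: measurable_box.
have muH : mu H = ((2 * l) ^+ n)%:E.
  rewrite borel_lebesgue_box; last by move=> _; lra.
  by rewrite prodr_const card_ord; congr ((_ ^+ _)%:E); lra.
have P0 := perimeter_ge0 E.
rewrite -muH.
apply: le_trans (@product_measure_defect_le E H _ mE mH _ _); last 2 first.
- move=> h Hh; apply: (le_trans (shift_defect_le h mE Eoo)).
  rewrite lee_wpmul2r// lee_fin.
  apply: (@le_trans _ _ (\sum_(i < n) l));
    last by rewrite sumr_const card_ord mulr_natl.
  by apply: ler_sum => i _; have /andP[h1 h2] := Hh i; rewrite ler_norml h1 ltW.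
- by rewrite mule_ge0// lee_fin mulr_ge0.
pose W k := [set p : Rn * Rn | [/\ (E `&` Q k) p.1,
  (Q k `\` E) (p.1 + p.2)%R & True]].
have mW k : measurable (W k).
  apply: (@measurable_pair_set (E `&` Q k) (Q k `\` E) setT) => //.
    exact: measurableI.
  exact: measurableD.
rewrite (eq_bigr (fun k => (mu \x mu)%E (W k))); last first.
  by move=> k _; rewrite product_measure_pair//;
    [exact: measurableI|exact: measurableD].
apply: (@sum_measure_disjoint_le _ _ _ (mu \x mu)%E) => //.
- exact: index_enum_uniq.
- by apply: measurable_pair_set => //; exact: measurableC.
- move=> k _ [x h] [/= [Ex Qx] [Qxh nExh] _]; split => //= i.
  by have := dQ k _ _ Qx Qxh i;
    rewrite !mxE addrAC subrr add0r ltr_norml => /andP[/ltW -> ->].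
- move=> k k' kk'; apply/seteqP; split => p //= [[[_ Qk] _ _] [[_ Qk'] _ _]].
  by rewrite -[False]/(set0 p.1) -(tQ _ _ kk').
Qed.

End poincare.

(** * Comparison of two sets on a grid *)

Section ultrafilter_limit.
Context {R : realType}.

(** Convergence along an ultrafilter of the bounded sequences [mu (A m `&`
    Q)], for all the cubes [Q] of all the grids at once, replaces diagonal
    extractions of subsequences. *)
Lemma ultrafilter_bounded_cvg (U : set_system nat) (a : nat -> R) (c : R) :
  UltraFilter U -> (forall m, `|a m| <= c) ->
  exists L, forall e, 0 < e -> U [set m | `|a m - L| < e].
Proof.
move=> UU ac.
have FU : ProperFilter (fmap a U) by exact: fmap_proper_filter.
have [|L [_ clL]] := @segment_compact R (- c) c (fmap a U) FU.
  have : U (a @^-1` [set t | t \in `[- c, c]]) by apply: filterE => m /=;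
    rewrite in_itv/= -ler_norml.
  by [] .
exists L => e e0.
have [//|nU] := in_ultra_setVsetC [set m | `|a m - L| < e] UU.
have [t [/= h1 h2]] := clL (~` [set t | `|t - L| < e]) (ball L e) nU
  (nbhsx_ballx L e e0).
by exfalso; apply: h1; move: h2; rewrite -ball_normE /= distrC.
Qed.

End ultrafilter_limit.

Section cube_comparison.
Context {R : realType} {n : nat}.
Local Notation Rn := 'rV[R]_n.
Local Notation mu := (@borel_lebesgue R n).

(** Indeed [Num.min e (q - e) <= 2 / q * (e * (q - e))]. If [e <= q / 2],
    bound [a] by [e], otherwise by [q - f = (q - e) + (e - f)]. *)
Lemma relative_isoperimetric_comparison (a e f q : R) : 0 < q -> 0 <= a ->
  a <= e -> a <= q - f -> e <= q -> a <= 2 / q * (e * (q - e)) + `|e - f|.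
Proof.
move=> q0 a0 ae aqf eq.
have N := ler_norm (e - f); have N0 := normr_ge0 (e - f).
have -> : 2 / q * (e * (q - e)) = (2 * (e * (q - e))) / q by ring.
rewrite -lerBlDr ler_pdivlMr//.
have [h|h] := leP (2 * e) q; nra.
Qed.

(** Only the first set enters through how unevenly it fills the cube; the
    second one enters through its measure in the cube alone. *)
Lemma measure_setD_cube_le (E F Q : set Rn) (q : R) :
  measurable E -> measurable F -> measurable Q -> 0 < q -> mu Q = q%:E ->
  (mu ((E `\` F) `&` Q) <=
   (2 / q)%:E * (mu (E `&` Q) * mu (Q `\` E)) +
   (`|fine (mu (E `&` Q)) - fine (mu (F `&` Q))|)%:E)%E.
Proof.
move=> mE mF mQ q0 muQ.
have fin A : measurable A -> A `<=` Q -> mu A \is a fin_num.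
  move=> mA AQ; rewrite ge0_fin_numE//; apply: (@le_lt_trans _ _ (mu Q)).
    by apply: le_measure; rewrite ?inE.
  by rewrite muQ ltry.
have mA : measurable ((E `\` F) `&` Q) by apply: measurableI => //;
  exact: measurableD.
have mEQ : measurable (E `&` Q) by exact: measurableI.
have mFQ : measurable (F `&` Q) by exact: measurableI.
have mQE : measurable (Q `\` E) by exact: measurableD.
have fA := fin _ mA (@subIsetr _ _ _).
have fE := fin _ mEQ (@subIsetr _ _ _).
have fF := fin _ mFQ (@subIsetr _ _ _).
have fD := fin _ mQE (@subDsetl _ _ _).
have DQ B : measurable B -> (mu Q = mu (Q `\` B) + mu (B `&` Q))%E.
  by move=> mB; rewrite (setIC B); exact: measureDI.
have qE := DQ E mE; have qF := DQ F mF; rewrite muQ in qE qF.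
have fQF : mu (Q `\` F) \is a fin_num by apply: fin;
  [exact: measurableD|exact: subDsetl].
move: qE qF; rewrite -(fineK fD) -(fineK fF) -(fineK fE) -(fineK fQF) -!EFinD.
move=> [qE] [qF].
have AE : (mu ((E `\` F) `&` Q) <= mu (E `&` Q))%E.
  by apply: le_measure; rewrite ?inE//; move=> x [[]].
have AF : (mu ((E `\` F) `&` Q) <= mu (Q `\` F))%E.
  apply: le_measure; rewrite ?inE//; first exact: measurableD.
  by move=> x [[Ex nFx] Qx].
move: AE AF; rewrite -(fineK fA) -{1}(fineK fE) -{1}(fineK fQF) !lee_fin =>
  AE AF.
have ge0 B : 0 <= fine (mu B) by rewrite fine_ge0.
have -> : fine (mu (Q `\` E)) = q - fine (mu (E `&` Q)) by rewrite qE addrK.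
apply: relative_isoperimetric_comparison => //.
  by rewrite qF addrK.
by rewrite qE lerDr.
Qed.

End cube_comparison.

Lemma measure_bigsetU_le {R : realType} {d} {T : measurableType d}
    (m : {measure set T -> \bar R}) (K : Type) (s : seq K) (W : K -> set T) :
  (forall k, measurable (W k)) ->
  (m (\big[setU/set0]_(k <- s) W k) <= \sum_(k <- s) m (W k))%E.
Proof.
move=> mW; elim: s => [|k s IH]; first by rewrite !big_nil measure0.
rewrite !big_cons; apply: (le_trans (measureU2 _ (mW k) _)).
  exact: bigsetU_measurable.
by rewrite leeD2l.
Qed.

Section grid.
Context {R : realType} {n : nat}.
Local Notation Rn := 'rV[R]_n.
Local Notation mu := (@borel_lebesgue R n).

Definition centered_box (M : R) : set Rn := box (fun=> - M) (fun=> M).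

Definition grid_cube (M : R) (N : nat) (k : {ffun 'I_n -> 'I_N.+1}) : set Rn :=
  box (fun i => - M + (k i)%:R * (2 * M / N.+1%:R))
      (fun i => - M + (k i).+1%:R * (2 * M / N.+1%:R)).

Variables (M : R) (N : nat).
Hypothesis M0 : 0 < M.
Let l := 2 * M / N.+1%:R.
Let l0 : 0 < l. Proof. by rewrite divr_gt0// mulr_gt0. Qed.

Lemma measurable_grid_cube k : measurable (@grid_cube M N k).
Proof. exact: measurable_box. Qed.

Lemma measure_grid_cube k : mu (@grid_cube M N k) = (l ^+ n)%:E.
Proof.
rewrite borel_lebesgue_box => [|i]; last by rewrite lerD2l ler_pM2r// ler_nat.
rewrite (eq_bigr (fun=> l)) ?prodr_const ?card_ord// => i _.
by rewrite -(natr1 (k i)) -/l; ring.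
Qed.

Lemma grid_cube_lt (k k' : {ffun 'I_n -> 'I_N.+1}) i x : grid_cube M k x ->
  grid_cube M k' x ->
  (k i < k' i)%N -> False.
Proof.
move=> /(_ i)/andP[_ h1] /(_ i)/andP[h2 _] kk'.
have : ((k i).+1%:R : R) * l <= (k' i)%:R * l by rewrite ler_pM2r// ler_nat.
move: h1 h2; rewrite -/l; lra.
Qed.

Lemma grid_cube_disjoint k k' : k != k' ->
  @grid_cube M N k `&` @grid_cube M N k' = set0.
Proof.
move=> kk'; apply/seteqP; split => x //= -[kx k'x].
have /existsP[i] : [exists i, k i != k' i].
  apply: contraNT kk'; rewrite negb_exists => /forallP H.
  by apply/eqP/ffunP => i; apply/eqP; rewrite -[_ == _]negbK.
by rewrite neq_ltn => /orP[]; [exact: (grid_cube_lt kx k'x)|exact: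
  (grid_cube_lt k'x kx)].
Qed.

Lemma grid_cube_diameter k x y : @grid_cube M N k x -> @grid_cube M N k y ->
  forall i, `|y ord0 i - x ord0 i| < l.
Proof.
move=> kx ky i; have /andP[x1 x2] := kx i; have /andP[y1 y2] := ky i.
move: x1 x2 y1 y2; rewrite -(natr1 (k i)) -/l ltr_norml mulrDl mul1r => *.
by apply/andP; split; lra.
Qed.

Lemma grid_cover x : centered_box M x -> exists k, @grid_cube M N k x.
Proof.
move=> xM; pose t i := (x ord0 i + M) / l.
have t0 i : 0 <= t i by have /= /andP[h _] := xM i;
  rewrite divr_ge0 ?(ltW l0)//; lra.
have tN i : t i < N.+1%:R.
  have /= /andP[_ h] := xM i; rewrite ltr_pdivrMr//.
  have -> : N.+1%:R * l = 2 * M by rewrite /l mulrC divfK.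
  lra.
exists [ffun i => inord (Num.truncn (t i))] => i; rewrite ffunE -/l inordK.
  have /andP[h1 h2] := truncn_itv (t0 i).
  move: h1 h2; rewrite /t ler_pdivlMr// ltr_pdivrMr// => h1 h2.
  by apply/andP; split; lra.
by rewrite -(ltr_nat R); apply: le_lt_trans (tN i); rewrite truncn_le.
Qed.

(** The constant is [2 / l ^ n], from [measure_setD_cube_le], times the
    constant [n * l * (2 * l) ^ n] of [poincare_cubes], where [l] is the side
    of the cubes. *)
Lemma measure_setD_grid_le (E F : set Rn) (p : R) :
  measurable E -> measurable F -> (mu E < +oo)%E -> (perimeter E <= p%:E)%E ->
  (mu (E `\` F) <= mu (E `\` centered_box M) +
    (2 ^+ n.+1 * n%:R * l * p)%:E +
    (\sum_(k : {ffun 'I_n -> 'I_N.+1})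
      `|fine (mu (E `&` grid_cube M k)) - fine (mu
        (F `&` grid_cube M k))|)%:E)%E.
Proof.
move=> mE mF Eoo Ep.
pose Q k := @grid_cube M N k.
have mQ k : measurable (Q k) by exact: measurable_grid_cube.
have mEF : measurable (E `\` F) by exact: measurableD.
have mEB : measurable (E `\` centered_box M) by apply: measurableD => //;
  exact: measurable_box.
have mU : measurable (\big[setU/set0]_k ((E `\` F) `&` Q k)).
  by apply: bigsetU_measurable => k _; exact: measurableI.
apply: (@le_trans _ _ (mu ((E `\` centered_box M) `|` \big[setU/set0]_k
  ((E `\` F) `&` Q k)))%E).
  apply: le_measure; rewrite ?inE//; first exact: measurableU.
  move=> x [Ex nFx]; have [xM|nxM] := pselect (centered_box M x); last by left.
  have [k kx] := grid_cover xM; right.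
  by rewrite -bigcup_seq; exists k => //=; rewrite mem_index_enum.
apply: (le_trans (measureU2 _ mEB mU)); rewrite -addeA leeD2l//.
apply: (le_trans (measure_bigsetU_le _ _ _)) => [k|]; first exact: measurableI.
have ln0 : 0 < l ^+ n by rewrite exprn_gt0.
apply: (@le_trans _ _ (\sum_k ((2 / l ^+ n)%:E * (mu (E `&` Q k) * mu
  (Q k `\` E)) +
   (`|fine (mu (E `&` Q k)) - fine (mu (F `&` Q k))|)%:E))%E).
  apply: lee_sum => k _; apply: measure_setD_cube_le => //.
  exact: measure_grid_cube.
rewrite big_split/= -sumEFin leeD2r//.
rewrite -ge0_sume_distrr => [|k _]; last by rewrite mule_ge0.
have H := @poincare_cubes R n _ Q l E
  (ltW l0) mQ grid_cube_disjoint grid_cube_diameter mE Eoo.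
apply: (@le_trans _ _ ((2 / l ^+ n)%:E * ((n%:R * l)%:E * perimeter E *
  ((2 * l) ^+ n)%:E))%E).
  by rewrite lee_wpmul2l// lee_fin divr_ge0// ltW.
apply: (@le_trans _ _ ((2 / l ^+ n)%:E * ((n%:R * l)%:E * p%:E *
  ((2 * l) ^+ n)%:E))%E).
  apply: lee_wpmul2l; first by rewrite lee_fin divr_ge0// ltW.
  apply: lee_wpmul2r; first by rewrite lee_fin exprn_ge0// mulr_ge0// ltW.
  by apply: lee_wpmul2l => //; rewrite lee_fin mulr_ge0// ltW.
rewrite -!EFinM lee_fin le_eqVlt; apply/orP; left; apply/eqP.
have -> : (2 * l) ^+ n = 2 ^+ n * l ^+ n by exact: exprMn.
rewrite exprS; move: (l ^+ n) ln0 (2 ^+ n) => L L0 T.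
by field; exact: lt0r_neq0.
Qed.

End grid.

(** * Compactness of sets of bounded perimeter *)

Section compactness.
Context {R : realType} {n : nat}.
Local Notation Rn := 'rV[R]_n.
Local Notation mu := (@borel_lebesgue R n).

(** A large box leaves little mass outside and a fine grid makes the Poincare
    term small. The measures in the finitely many cubes of this grid converge
    along [U], so that they are almost equal for all the indices in a member
    of [U]. *)
Lemma ultrafilter_measure_setD_small (A : nat -> set Rn) (U : set_system nat)
    (c p e : R) :
  UltraFilter U -> (forall m, measurable (A m)) ->
  (forall m, mu (A m) <= c%:E)%E -> 0 <= p ->
  (forall m, perimeter (A m) <= p%:E)%E ->
  (forall e, 0 < e -> exists2 M, 0 < M &
     forall m, (mu (A m `\` centered_box M) <= e%:E)%E) ->
  0 < e -> exists2 S, U S & forall m m',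
    S m -> S m' -> (mu (A m `\` A m') <= e%:E)%E.
Proof.
move=> UU mA Ac p0 Ap tight e0.
have e30 : 0 < e / 3 by rewrite divr_gt0.
have [M M0 HM] := tight _ e30.
pose C := 2 ^+ n.+1 * n%:R * (2 * M) * p.
have C0 : 0 <= C by rewrite !mulr_ge0// ltW.
pose N := Num.truncn (C / (e / 3)).
pose K := {ffun 'I_n -> 'I_N.+1}.
(* Two indices of the member of [U] differ by at most [2 * eta] on each cube. *)
pose eta := e / 3 / (2 * #|K|.+1%:R).
have eta0 : 0 < eta by rewrite divr_gt0// mulr_gt0.
pose a (k : K) m := fine (mu (A m `&` grid_cube M k)).
have ac k m : `|a k m| <= `|c|.
  have mI : measurable (A m `&` grid_cube M k).
    by apply: measurableI => //; exact: measurable_grid_cube.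
  have h : (mu (A m `&` grid_cube M k) <= c%:E)%E.
    apply: le_trans (Ac m); apply: le_measure; rewrite ?inE//; exact: subIsetl.
  have f : mu (A m `&` grid_cube M k) \is a fin_num.
    by rewrite ge0_fin_numE//; apply: le_lt_trans h _; rewrite ltry.
  rewrite ger0_norm ?fine_ge0// (le_trans _ (ler_norm c))//.
  by rewrite -lee_fin fineK.
have lim k := ultrafilter_bounded_cvg UU (ac k).
pose L k := projT1 (cid (lim k)); have LP k := projT2 (cid (lim k)).
exists [set m | forall k, `|a k m - L k| < eta].
  by apply: filter_forall => k; exact: LP.
move=> m m' Sm Sm'.
have mE := mA m; have mF := mA m'.
have Eoo : (mu (A m) < +oo)%E by apply: le_lt_trans (Ac m) _; rewrite ltry.
apply: (le_trans (measure_setD_grid_le N M0 mE mF Eoo (Ap m))).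
have -> : e = e / 3 + e / 3 + e / 3 by lra.
rewrite !EFinD; apply: leeD; first apply: leeD => //.
  rewrite lee_fin (_ : _ * _ = C / N.+1%:R); last by rewrite /C; ring.
  rewrite ler_pdivrMr// mulrC -ler_pdivrMr//.
  exact: ltW (truncnS_gt _).
rewrite lee_fin; apply: (@le_trans _ _ (\sum_(k : K) (2 * eta))).
  apply: ler_sum => k _.
  rewrite -(subrKA (L k)); apply: le_trans (ler_normD _ _) _.
  rewrite (distrC (L k)) mulr2n mulrDl mul1r; apply: lerD; apply: ltW.
    exact: Sm.
  exact: Sm'.
rewrite sumr_const -[leLHS]mulr_natl /eta.
have k0 : #|K|.+1%:R != 0 :> R by rewrite pnatr_eq0.
rewrite (_ : _ * _ = e / 3 * (#|K|%:R / #|K|.+1%:R)); last first.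
  by move: (#|K|.+1%:R) k0 => D k0; field.
apply: ler_piMr; first exact: ltW.
by rewrite ler_pdivrMr// mul1r ler_nat.
Qed.

Definition set_liminf (A : nat -> set Rn) : set Rn :=
  \bigcup_k \bigcap_(j in [set j | (k <= j)%N]) A j.

Lemma measurable_tail_bigcap (A : nat -> set Rn) k : (forall j,
  measurable (A j)) ->
  measurable (\bigcap_(j in [set j | (k <= j)%N]) A j).
Proof. by move=> mA; apply: bigcap_measurable => //; exists k => /=. Qed.

Lemma measurable_set_liminf (A : nat -> set Rn) : (forall j,
  measurable (A j)) ->
  measurable (set_liminf A).
Proof.
by move=> mA; apply: bigcupT_measurable => k; exact: measurable_tail_bigcap.
Qed.

Lemma measure_geometric_bigcup_le (D : nat -> set Rn) j :
  (forall i, measurable (D i)) ->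
  (forall i, (mu (D i) <= ((2 ^ i)%:R^-1)%:E)%E) ->
  (mu (\bigcup_i D (j + i)%N) <= (2 / (2 ^ j)%:R)%:E)%E.
Proof.
move=> mD Dle.
apply: (@le_trans _ _ (\sum_(0 <= i <oo) mu (D (j + i)%N))%E).
  by apply: measure_sigma_subadditive => //; exact: bigcupT_measurable.
apply: le_trans (epsilon_trick0 xpredT _); last by rewrite divr_ge0.
apply: lee_nneseries => // i _; apply: (le_trans (Dle _)).
rewrite lee_fin expnD expnS !natrM le_eqVlt; apply/orP; left; apply/eqP.
by field; rewrite !pnatr_eq0 !expn_eq0.
Qed.

(** A point of exactly one of two members of the sequence enters or leaves
    between two consecutive members, so Borel-Cantelli applies. *)
Lemma measure_set_liminf (A : nat -> set Rn) :
  (forall j, measurable (A j)) ->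
  (forall j, (mu (A j `\` A j.+1) <= ((2 ^ j)%:R^-1)%:E)%E) ->
  (forall j, (mu (A j.+1 `\` A j) <= ((2 ^ j)%:R^-1)%:E)%E) ->
  forall j, (mu (set_liminf A `\` A j) <= (2 / (2 ^ j)%:R)%:E)%E /\
            (mu (A j `\` set_liminf A) <= (2 / (2 ^ j)%:R)%:E)%E.
Proof.
move=> mA dA uA j; have mE := measurable_set_liminf mA; split.
- apply: le_trans (measure_geometric_bigcup_le j _ uA); last by move=> i;
    exact: measurableD.
  apply: le_measure; rewrite ?inE; first exact: measurableD.
    by apply: bigcupT_measurable => i; exact: measurableD.
  move=> x [[k _ Ek] nAj]; apply: contrapT => nx.
  have H i : ~ A (j + i)%N x.
    elim: i => [|i IH]; first by rewrite addn0.
    by move=> Ax; apply: nx; exists i => //; rewrite -addnS.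
  by apply: (H k); apply: Ek => /=; rewrite leq_addl.
- apply: le_trans (measure_geometric_bigcup_le j _ dA); last by move=> i;
    exact: measurableD.
  apply: le_measure; rewrite ?inE; first exact: measurableD.
    by apply: bigcupT_measurable => i; exact: measurableD.
  move=> x [Aj nE]; apply: contrapT => nx; apply: nE; exists j => // i /= ji.
  have H i' : A (j + i')%N x.
    elim: i' => [|i' IH]; first by rewrite addn0.
    by apply: contrapT => nA; apply: nx; exists i' => //; split => //;
      rewrite -addnS.
  by rewrite -(subnKC ji).
Qed.

(** The index [s j] is taken in the first [j.+1] of a sequence of members of
    the ultrafilter with smaller and smaller oscillation. *)
Lemma compactness_tight_perimeter (A : nat -> set Rn) (c p : R) :
  (forall m, measurable (A m)) ->
  (forall m, mu (A m) <= c%:E)%E -> 0 <= p ->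
  (forall m, perimeter (A m) <= p%:E)%E ->
  (forall e, 0 < e -> exists2 M, 0 < M &
     forall m, (mu (A m `\` centered_box M) <= e%:E)%E) ->
  exists2 s : nat -> nat, forall j, (j <= s j)%N &
    forall j, (mu (set_liminf (A \o s) `\` A (s j)) <= (2 / (2 ^ j)%:R)%:E)%E /\
              (mu (A (s j) `\` set_liminf (A \o s)) <= (2 / (2 ^ j)%:R)%:E)%E.
Proof.
move=> mA Ac p0 Ap tight.
have [U [UU Uoo]] := ultraFilterLemma eventually_filter.
have small j : exists2 S, U S & forall m m', S m -> S m' ->
    (mu (A m `\` A m') <= ((2 ^ j)%:R^-1)%:E)%E.
  apply: (ultrafilter_measure_setD_small UU mA Ac p0 Ap tight).
  by rewrite invr_gt0 ltr0n expn_gt0.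
pose S j := projT1 (cid2 (small j)).
have US j : U (S j) by rewrite /S; case: cid2.
have SP j m m' : S j m -> S j m' -> (mu (A m `\` A m') <= ((2 ^ j)%:R^-1)%:E)%E.
  by rewrite /S; case: cid2 => /= T _; apply.
have pick j : exists m, (j <= m)%N /\ forall i, (i <= j)%N -> S i m.
  have : U [set m | forall i : 'I_j.+1, S i m] by apply: filter_forall => i;
    exact: US.
  have : U [set m | (j <= m)%N] by apply: Uoo; exists j.
  move=> /filterI H /H /filter_ex [m [/= jm Sm]]; exists m; split => // i ij.
  by have := Sm (Ordinal (ij : (i < j.+1)%N)).
pose s j := projT1 (cid (pick j)); have sP j := projT2 (cid (pick j)).
exists s; first by move=> j; have [] := sP j.
apply: measure_set_liminf => [j|j|j]; first exact: mA.
- by apply: SP; [exact: (sP j).2|exact: ((sP j.+1).2 j (leqnSn j))].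
- by apply: SP; [exact: ((sP j.+1).2 j (leqnSn j))|exact: (sP j).2].
Qed.

End compactness.

(** * Interaction energies *)

Section interaction.
Context {R : realType} {n : nat}.
Local Notation Rn := 'rV[R]_n.
Local Notation mu := (@borel_lebesgue R n).
Local Notation shift_set v E := ((fun x : Rn => x + v)%R @^-1` E).
Variable K : Rn -> R.
Hypothesis mK : measurable_fun setT K.
Hypothesis K0 : forall z, 0 <= K z.

Definition interaction (E : set Rn) : \bar R :=
  (\int[mu]_(y in E) \int[mu]_(x in E) (K (x - y)%R)%:E)%E.

Let mKy (y : Rn) : measurable_fun setT (fun x : Rn => (K (x - y))%:E).
Proof.
apply/measurable_EFinP; apply: (measurableT_comp mK).
exact: measurable_rV_add.
Qed.

Let mK2 : measurable_fun setT (fun p : Rn * Rn => (K (p.2 - p.1))%:E).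
Proof.
apply/measurable_EFinP; apply: (measurableT_comp mK).
rewrite (_ : (fun _ => _) = (fun p : Rn * Rn => p.1 - p.2) \o (fun p => (p.2,
  p.1)))//.
apply: measurableT_comp; first exact: measurable_rV_sub.
by apply/measurable_fun_pairP; split;
  [exact: measurable_snd|exact: measurable_fst].
Qed.

(** As an integral over a product set the interaction falls under monotone
    convergence for increasing sets. *)
Lemma interaction_product (E : set Rn) : measurable E ->
  interaction E =
  (\int[mu \x mu]_(p in E `*` E) (K (p.2 - p.1)%R)%:E)%E.
Proof.
move=> mE; rewrite [RHS]integral_mkcond fubini_tonelli1; last 2 first.
- apply/(measurable_restrictT _ (measurableX mE mE)).
  exact: measurable_funTS.
- by move=> p; apply: erestrict_ge0 => q _; rewrite lee_fin.
rewrite /interaction integral_mkcond; apply: eq_integral => y _; rewrite patchE.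
rewrite /fubini_F; case: ifPn => yE.
  rewrite [LHS]integral_mkcond; apply: eq_integral => x _.
  by rewrite !patchE in_setX yE.
by rewrite [RHS]integral0_eq// => x _; rewrite patchE in_setX (negbTE yE).
Qed.

Lemma interaction_ge0 E : (0 <= interaction E)%E.
Proof.
by apply: integral_ge0 => y _; apply: integral_ge0 => x _; rewrite lee_fin.
Qed.

Lemma measurable_inner_interaction (E : set Rn) : measurable E ->
  measurable_fun setT (fun y : Rn => \int[mu]_(x in E) (K (x - y)%R)%:E)%E.
Proof.
move=> mE; pose f (p : Rn * Rn) :=
  ((fun p : Rn * Rn => (K (p.2 - p.1))%:E) \_ (setT `*` E)) p.
have f0 p : (0 <= f p)%E by apply: erestrict_ge0 => q _; rewrite lee_fin.
have mf : measurable_fun setT f.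
  apply/(measurable_restrictT _ (measurableX measurableT mE)).
  exact: measurable_funTS.
have := @measurable_fun_fubini_tonelli_F _ _ _ _ R mu f mf f0.
apply: eq_measurable_fun => y _; rewrite /fubini_F [RHS]integral_mkcond.
by apply: eq_integral => x _; rewrite /f !patchE in_setX in_setT.
Qed.

Lemma interaction_shift (E : set Rn) v : measurable E ->
  interaction (shift_set v E) = interaction E.
Proof.
move=> mE; rewrite /interaction.
rewrite -[RHS](ge0_integral_shift v mE (measurable_inner_interaction mE));
  last first.
  by move=> y; apply: integral_ge0 => x _; rewrite lee_fin.
apply: eq_integral => y _.
rewrite -[RHS](ge0_integral_shift v mE (mKy (y + v))); last by move=> x;
  rewrite lee_fin.
by apply: eq_integral => x _; rewrite opprD addrACA subrr addr0.
Qed.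

Lemma interaction_lebesgue (E B : set Rn) : lebesgue_measurable E ->
  measurable B -> E `<=` B -> lebesgue_rV (B `\` E) = 0%E ->
  (\int[lebesgue_rV]_(y in E) \int[lebesgue_rV]_(x in E) (K ((x : Rn)
    - y)%R)%:E =
   interaction B)%E.
Proof.
move=> mE mB EB N0; rewrite /interaction.
rewrite -(integral_lebesgue_rV mE mB EB N0 (measurable_inner_interaction mB)).
by apply: eq_integral => y _; exact: integral_lebesgue_rV.
Qed.

Lemma le_interaction (E F : set Rn) : measurable E -> measurable F ->
  E `<=` F ->
  (interaction E <= interaction F)%E.
Proof.
move=> mE mF EF; rewrite !interaction_product//.
apply: ge0_subset_integral => //; try exact: measurableX.
- exact: measurable_funTS.
- by move=> p _; rewrite lee_fin.
- by move=> p [/= ? ?]; split; exact: EF.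
Qed.

Lemma cvg_interaction_bigcup (G : nat -> set Rn) :
  (forall k, measurable (G k)) -> nondecreasing_seq G ->
  interaction (G k) @[k --> \oo] --> interaction (\bigcup_k G k).
Proof.
move=> mG ndG; rewrite interaction_product; last exact: bigcupT_measurable.
under eq_fun do rewrite interaction_product//.
rewrite (_ : _ `*` _ = \bigcup_k (G k `*` G k)).
  apply: (@ge0_nondecreasing_set_cvg_integral _ _ R (fun k =>
    G k `*` G k) _ (mu \x mu)%E).
  - move=> k k' kk'; apply/subsetPset => p [/= h1 h2].
    by split; move: (ndG _ _ kk') => /subsetPset; apply.
  - by move=> k; exact: measurableX.
  - by move=> k; exact: measurable_funTS.
  - by move=> k p _; rewrite lee_fin.
apply/seteqP; split => -[x y] /=.
  move=> [[k1 _ h1] [k2 _ h2]]; exists (maxn k1 k2) => //; split => /=.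
    by move: (ndG _ _ (leq_maxl k1 k2)) => /subsetPset; apply.
  by move: (ndG _ _ (leq_maxr k1 k2)) => /subsetPset; apply.
by move=> [k _ [/= h1 h2]]; split; exists k.
Qed.

End interaction.

(** * Admissible vector fields *)

Section admissible_fields.
Context {R : realType} {n : nat}.
Local Notation Rn := 'rV[R]_n.
Local Notation mu := (@borel_lebesgue R n).
Local Notation e_ i := (delta_mx ord0 i : Rn).
Local Notation shift_set v E := ((fun x : Rn => x + v)%R @^-1` E).

Lemma ler_coord_norm (x : Rn) i : `|x ord0 i| <= `|x|.
Proof.
by rewrite [leRHS]/Num.Def.normr/= mx_normrE; exact: (le_bigmax _ _ (ord0, i)).
Qed.

Lemma compactly_supported_bound (phi : Rn -> Rn) : compactly_supported phi ->
  exists M, forall x, phi x != 0 -> forall i, `|x ord0 i| <= M.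
Proof.
move=> /compact_bounded[M [_ HM]]; exists (M + 1) => x phix i.
apply: le_trans (ler_coord_norm x i) _.
by apply: (HM (M + 1)); [rewrite ltrDl|exact: subset_closure].
Qed.

Lemma admissible_shift (phi : Rn -> Rn) v : admissible phi ->
  admissible (fun x => phi (x + v)).
Proof.
move=> [[dphi cphi] sphi bphi]; split; last by move=> x; exact: bphi.
- split=> [x|w].
    exact: differentiable_shift_rV.
  rewrite (_ : 'D_w _ = fun x => 'D_w phi (x + v)); last first.
    by apply/funext => x; exact: derive_shift_rV.
  move=> x; apply: (@continuous_comp _ _ _ (fun y : Rn => y + v) ('D_w phi));
    last exact: cphi.
  exact: (differentiable_continuous (f := fun z : Rn => z + v)).
- have [M HM] := compactly_supported_bound sphi.
  apply: (@compactly_supported_box _ _ _ (M + `|v|)) => x phix i.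
  have := HM _ phix i; rewrite mxE => h.
  rewrite -[x ord0 i](addrK (v ord0 i)); apply: (le_trans (ler_normB _ _)).
  by rewrite lerD// ler_coord_norm.
Qed.

Lemma div_field_shift (phi : Rn -> Rn) v x :
  div_field (fun y => phi (y + v)) x = div_field phi (x + v).
Proof. by apply: eq_bigr => i _; rewrite derive_shift_rV. Qed.

Lemma perimeter_shift_le (E : set Rn) v : measurable E ->
  (perimeter (shift_set v E) <= perimeter E)%E.
Proof.
move=> mE; apply: perimeter_le; first exact: measurable_preimage_add.
move=> phi aphi; have aphi' := admissible_shift (- v) aphi.
apply: le_trans (integral_div_le_perimeter mE aphi').
have md : measurable_fun setT (fun x => (div_field (fun y =>
  phi (y - v)) x)%:E).
  by apply: measurable_div_field; case: aphi'.
rewrite -(integral_shift v mE md) le_eqVlt; apply/orP; left; apply/eqP.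
by apply: eq_integral => x _; rewrite div_field_shift addrK.
Qed.

Lemma derive_locally_zero (phi : Rn -> Rn) v x : (\forall y \near x,
  phi y = 0) ->
  'D_v phi x = 0.
Proof.
by move=> H; rewrite (@near_eq_derive _ _ _ phi (cst 0) x v H) derive_cst.
Qed.

(** On the support by compactness; off the support the field vanishes
    locally. *)
Lemma bounded_derive (phi : Rn -> Rn) v : C1 phi -> compactly_supported phi ->
  exists2 C, 0 <= C & forall x, `|'D_v phi x| <= C.
Proof.
move=> [_ cphi] sphi.
have : compact ('D_v phi @` closure [set x | phi x != 0]).
  by apply: continuous_compact => //; exact: continuous_subspaceT (cphi v).
move=> /compact_bounded[M [_ HM]]; exists (`|M| + 1); first by rewrite addr_ge0.
move=> x; have [Sx|nSx] := pselect (closure [set x | phi x != 0] x).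
  apply: (HM (`|M| + 1)); last by exists x.
  by rewrite ltr_pwDr// ler_norm.
rewrite derive_locally_zero ?normr0 ?addr_ge0//.
have : open (~` closure [set x | phi x != 0]) by apply: closed_openC;
  exact: closed_closure.
move=> oS; move: (open_nbhs_nbhs (conj oS nSx)).
apply: filterS => y nSy; apply/eqP; rewrite -[_ == _]negbK; apply/negP => phiy.
by apply: nSy; exact: subset_closure.
Qed.

Lemma bounded_div_field (phi : Rn -> Rn) : admissible phi ->
  exists2 C, 0 <= C & forall x, `|div_field phi x| <= C.
Proof.
move=> [Cphi sphi _]; have bd i := bounded_derive (e_ i) Cphi sphi.
pose c i := projT1 (cid2 (bd i)).
have c0 i : 0 <= c i by rewrite /c; case: cid2.
have cP i x : `|'D_(e_ i) phi x| <= c i by rewrite /c; case: cid2.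
exists (\sum_i c i); first exact: sumr_ge0.
move=> x; apply: (le_trans (ler_norm_sum _ _ _)); apply: ler_sum => i _.
exact: le_trans (ler_coord_norm _ i) (cP i x).
Qed.

(** The integral of a bounded function is Lipschitz with respect to the
    measure of the symmetric difference; this gives the lower semicontinuity
    of the perimeter. *)
Lemma integral_bounded_setD_le (E F : set Rn) (f : Rn -> R) (C d : R) :
  measurable E -> measurable F -> (mu E < +oo)%E -> (mu F < +oo)%E ->
  measurable_fun setT f -> 0 <= C -> (forall x, `|f x| <= C) ->
  (mu (E `\` F) <= d%:E)%E -> (mu (F `\` E) <= d%:E)%E ->
  (\int[mu]_(x in E) (f x)%:E <=
   \int[mu]_(x in F) (f x)%:E + (C * d + C * d)%:E)%E.
Proof.
move=> mE mF Eoo Foo mf C0 fC Ed Fd.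
have mI : measurable (E `&` F) by exact: measurableI.
have mEF : measurable (E `\` F) by exact: measurableD.
have mFE : measurable (F `\` E) by exact: measurableD.
have small D : measurable D -> (mu D <= d%:E)%E ->
    (`|\int[mu]_(x in D) (f x)%:E| <= (C * d)%:E)%E.
  move=> mD Dd; have mfD : measurable_fun D (fun x => (f x)%:E).
    by apply: measurable_funTS; exact/measurable_EFinP.
  apply: le_trans (le_abse_integral mu mD mfD) _.
  apply: (@le_trans _ _ (C%:E * mu D)%E).
    apply: (integral_le_bound _ mD mfD); first by rewrite lee_fin.
    by apply: aeW => x _; rewrite /= lee_fin.
  by rewrite EFinM lee_wpmul2l// lee_fin.
have split_int A B : measurable A -> measurable B -> (mu A < +oo)%E ->
    (\int[mu]_(x in A) (f x)%:E = \int[mu]_(x in A `&` B) (f x)%:E +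
       \int[mu]_(x in A `\` B) (f x)%:E)%E.
  move=> mA mB Aoo; rewrite -integral_setU ?setUIDK//.
  - exact: measurableI.
  - exact: measurableD.
  - by apply: measurable_funTS; exact/measurable_EFinP.
  - by apply/disj_setPLR => x [_ Bx] [].
rewrite (split_int E F)// (split_int F E)// (setIC F E).
have := small _ mEF Ed; have := small _ mFE Fd.
have fin D : measurable D -> (mu D <= d%:E)%E ->
    (\int[mu]_(x in D) (f x)%:E)%E \is a fin_num.
  by move=> mD Dd; rewrite fin_num_abs; apply: le_lt_trans (small D mD Dd) _;
    rewrite ltry.
rewrite -(fineK (fin _ mEF Ed)) -(fineK (fin _ mFE Fd)) !lee_fin => h1 h2.
rewrite -addeA leeD2l// -EFinD lee_fin.
by move: h1 h2; rewrite !ler_norml; lra.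
Qed.

End admissible_fields.

(** * Cubes have finite perimeter *)

Section cube.
Context {R : realType} {n : nat}.
Local Notation Rn := 'rV[R]_n.
Local Notation mu := (@borel_lebesgue R n).
Local Notation e_ i := (delta_mx ord0 i : Rn).
Local Notation shift_set v E := ((fun x : Rn => x + v)%R @^-1` E).

Lemma C1_coord (phi : Rn -> Rn) i : C1 phi -> C1s (fun x => phi x ord0 i).
Proof.
move=> [dphi cphi]; split=> [x|v].
  apply: (@differentiable_comp _ _ _ _ phi (fun y : Rn => y ord0 i)) => //.
  exact: differentiable_coord.
rewrite (_ : 'D_v _ = fun x => ('D_v phi x) ord0 i).
  move=> x; apply: (@continuous_comp _ _ _ ('D_v phi) (fun y : Rn => y ord0 i)).
    exact: cphi.
  exact: coord_continuous.
apply/funext => x; rewrite (derive_mx (diff_derivable (dphi x))) mxE//.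
Qed.

Lemma derive_C1_coord (phi : Rn -> Rn) v i x : C1 phi ->
  'D_v (fun x => phi x ord0 i) x = ('D_v phi x) ord0 i.
Proof.
by move=> [dphi _]; rewrite (derive_mx (diff_derivable (dphi x))) mxE.
Qed.

Lemma ler_coord_enorm (x : Rn) i : `|x ord0 i| <= enorm x.
Proof.
rewrite /enorm -sqrtr_sqr ler_sqrt; last by apply: sumr_ge0 => j _;
  exact: sqr_ge0.
by rewrite (bigD1 i)//= lerDl sumr_ge0// => j _; exact: sqr_ge0.
Qed.

Lemma cvg_difference_quotient (g : Rn -> R) v x : C1s g ->
  k.+1%:R * (g (x + k.+1%:R^-1 *: v) - g x) @[k --> \oo] --> ('D_v g x : R).
Proof.
move=> [dg _]; have dx := diff_derivable (v := v) (dg x).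
pose q (h : R) := h^-1 *: ((g \o shift x) (h *: v) - g x).
have cq : q h @[h --> 0^'] --> ('D_v g x : R) by exact: dx.
have ch : (@harmonic R) k @[k --> \oo] --> 0^'.
  move=> A nA; have H : \forall k \near \oo,
    (@harmonic R) k != 0 -> A (harmonic k).
    exact: (@cvg_harmonic R _ nA).
  by apply: filterS H => k; apply; rewrite invr_eq0 pnatr_eq0.
have := cvg_comp _ _ ch cq; apply: cvg_trans; apply: near_eq_cvg;
  apply: nearW => k.
by rewrite /q /harmonic /= invrK [X in _ *: (g X - _)]addrC.
Qed.

(** Integrating a partial derivative amounts, in the limit of difference
    quotients, to comparing the set with its translates. *)
Lemma integral_derive_le (E : set Rn) (g : Rn -> R) i (C c : R) :
  measurable E -> (mu E < +oo)%E -> C1s g -> (forall x, `|g x| <= 1) ->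
  (forall x, `|'D_(e_ i) g x| <= C) ->
  (forall h, 0 < h -> (mu (shift_set (- (h *: e_ i)) E `\` E) <=
    (h * c)%:E)%E /\
                      (mu (E `\` shift_set (- (h *: e_ i)) E) <=
                        (h * c)%:E)%E) ->
  (\int[mu]_(x in E) ('D_(e_ i) g x)%:E <= (2 * c)%:E)%E.
Proof.
move=> mE Eoo Cg g1 dgC Ec.
have mg : measurable_fun setT g
  by exact: continuous_measurable_rV (C1s_continuous Cg).
have mdg : measurable_fun setT ('D_(e_ i) g).
  by apply: continuous_measurable_rV; exact: Cg.2.
pose h (k : nat) : R := k.+1%:R^-1.
have h0 k : 0 < h k by rewrite invr_gt0.
pose q (k : nat) (x : Rn) := k.+1%:R * (g (x + h k *: e_ i) - g x).
have mgs k : measurable_fun setT (fun x : Rn => g (x + h k *: e_ i)).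
  by apply: (measurableT_comp mg); exact: measurable_rV_add.
have mq k : measurable_fun setT (q k).
  by apply: measurable_funM => //; apply: measurable_funB.
have qC k x : `|q k x| <= C.
  have [t _ E1] := MVT_line x (e_ i) Cg (h0 k).
  by rewrite /q E1 mulrA divff ?mul1r// pnatr_eq0.
have [_ _ cvq] := @dominated_convergence _ _ _ mu E mE (fun k => EFin \o q k)
    (EFin \o 'D_(e_ i) g) (cst C%:E) ltac:(by move=> k; apply/measurable_EFinP;
      exact: measurable_funTS)
    ltac:(by apply/measurable_EFinP; exact: measurable_funTS)
    ltac:(by apply: aeW => x _; apply: cvg_EFin;
      [exact: nearW|exact: cvg_difference_quotient])
    ltac:(by apply: (bounded_integrable (c := `|C|) (f := cst C)))
    ltac:(by apply: aeW => x k _ /=; rewrite lee_fin).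
apply: cvge_le cvq; apply: nearW => k.
pose D := shift_set (- (h k *: e_ i)) E.
have mD : measurable D by exact: measurable_preimage_add.
have Doo : (mu D < +oo)%E by rewrite borel_lebesgue_shift.
have ig := bounded_integrable mE Eoo mg g1.
have igs := bounded_integrable mE Eoo (mgs k) (fun x => g1 (x + h k *: e_ i)).
rewrite /q /=; under eq_integral do rewrite EFinM EFinB.
rewrite integralZl//; last exact: integrableB.
rewrite integralB//.
have -> : (\int[mu]_(x in E) (g (x + h k *: e_ i)%R)%:E =
  \int[mu]_(x in D) (g x)%:E)%E.
  rewrite -(@integral_shift _ _ (h k *: e_ i) D (fun x => (g x)%:E))//;
    last exact/measurable_EFinP.
  by congr integral; apply/seteqP; split => x; rewrite /D /= addrK.
have [c1 c2] := Ec _ (h0 k).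
have := integral_bounded_setD_le mD mE Doo Eoo mg ler01 g1 c1 c2.
have f1 : (\int[mu]_(x in E) (g x)%:E)%E \is a fin_num
  by exact: integrable_fin_num.
rewrite addeC -leeBlDr// => H.
apply: (@le_trans _ _ (k.+1%:R%:E * (1 * (h k * c) + 1 * (h k * c))%:E)%E).
  by apply: lee_wpmul2l => //; rewrite lee_fin.
rewrite -EFinM lee_fin le_eqVlt; apply/orP; left; apply/eqP.
have k0 : k.+1%:R != 0 :> R by rewrite pnatr_eq0.
by rewrite /h; move: (k.+1%:R) k0 => u u0; field.
Qed.

(** Both differences lie in boxes of width [h] in the direction [i]. *)
Lemma cube_shift_defect (L h : R) i : 0 < L -> 0 < h ->
  let Q : set Rn := box (fun=> 0) (fun=> L) in
  let c := \prod_(j < n | j != i) L in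
  (mu (shift_set (- (h *: e_ i)) Q `\` Q) <= (h * c)%:E)%E /\
  (mu (Q `\` shift_set (- (h *: e_ i)) Q) <= (h * c)%:E)%E.
Proof.
move=> L0 h0 Q c.
pose B (a : R) : set Rn := box (fun j => if j == i then a else 0) (fun j =>
  if j == i then a + h else L).
have muB a : mu (B a) = (h * c)%:E.
  rewrite borel_lebesgue_box; last by move=> j; case: ifP => _; lra.
  rewrite (bigD1 i)//= eqxx; congr (_ * _)%:E; first by lra.
  by apply: eq_bigr => j /negbTE ->; rewrite subr0.
have mQ : measurable Q by exact: measurable_box.
have mS := measurable_preimage_add (- (h *: e_ i)) mQ.
have coord (x : Rn) j : (x - h *: e_ i) ord0 j =
  if j == i then x ord0 j - h else x ord0 j.
  by rewrite !mxE eqxx/=; case: (j == i); rewrite ?mulr1// mulr0 subr0.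
split.
- rewrite -(muB L); apply: le_measure; rewrite ?inE.
  + exact: measurableD.
  + exact: measurable_box.
  + move=> x [Sx nQx] j; have := Sx j; rewrite coord;
      case: eqP => [ji|_] // /andP[s1 s2].
    apply/andP; split; last lra.
    rewrite leNgt; apply/negP => xL; apply: nQx => j'.
    have := Sx j'; rewrite coord; case: eqP => [->|//]; rewrite -ji => _.
    by apply/andP; split; lra.
- rewrite -(muB 0); apply: le_measure; rewrite ?inE.
  + exact: measurableD.
  + exact: measurable_box.
  + move=> x [Qx nSx] j; have := Qx j; case: eqP => [ji|_] // /andP[s1 s2].
    apply/andP; split; first by [].
    rewrite add0r ltNge; apply/negP => xh; apply: nSx => j'; rewrite coord.
    have := Qx j'; case: eqP => [->|//]; rewrite -ji => _.
    by apply/andP; split; lra.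
Qed.

Lemma perimeter_cube_lt_pinfty (L : R) : 0 < L ->
  (perimeter (box (fun=> 0%R) (fun=> L) : set Rn) < +oo)%E.
Proof.
move=> L0; set Q := box _ _.
have mQ : measurable Q by exact: measurable_box.
have Qoo : (mu Q < +oo)%E by rewrite borel_lebesgue_box ?ltry// => i;
  exact: ltW.
apply: (@le_lt_trans _ _ (\sum_(i < n) 2 * \prod_(j < n | j != i) L)%:E);
  last exact: ltry.
apply: perimeter_le => // phi [Cphi sphi bphi].
have bd i := bounded_derive (e_ i) Cphi sphi.
have dC i x : `|'D_(e_ i) (fun x => phi x ord0 i) x| <= projT1 (cid2 (bd i)).
  by case: cid2 => C /= _ HC; rewrite derive_C1_coord//;
    exact: le_trans (ler_coord_norm _ i) (HC x).
have Cc i := C1_coord i Cphi.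
rewrite (eq_integral (fun x => \sum_(i < n) ('D_(e_ i) (fun x =>
  phi x ord0 i) x)%:E)%E); last first.
  move=> x _; rewrite sumEFin; congr EFin; apply: eq_bigr => i _.
  by rewrite derive_C1_coord.
rewrite integral_sum//; last first.
  move=> i; apply: (bounded_integrable mQ Qoo _ (dC i)).
  by apply: continuous_measurable_rV; exact: (Cc i).2.
rewrite -sumEFin; apply: lee_sum => i _.
apply: (integral_derive_le mQ Qoo (Cc i) _ (dC i)).
  by move=> x; exact: le_trans (ler_coord_enorm _ i) (bphi x).
by move=> h h0; exact: cube_shift_defect.
Qed.

Lemma exists_finite_perimeter (V : R) : 0 < V -> (0 < n)%N ->
  exists Q : set Rn, [/\ measurable Q, mu Q = V%:E & (perimeter Q < +oo)%E].
Proof.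
move=> V0 n0; have L0 : 0 < V `^ n%:R^-1 by rewrite powR_gt0.
exists (box (fun=> 0%R) (fun=> V `^ n%:R^-1)); split.
- exact: measurable_box.
- rewrite borel_lebesgue_box => [|i]; last exact: ltW.
  rewrite subr0 prodr_const card_ord -powR_mulrn ?ltW//
    -powRrM mulVf ?powRr1 ?ltW//.
  by rewrite pnatr_eq0 -lt0n.
- exact: perimeter_cube_lt_pinfty.
Qed.

End cube.

(** * Existence of a minimizer among Borel sets *)

Section direct_method.
Context {R : realType} {n : nat}.
Local Notation Rn := 'rV[R]_n.
Local Notation mu := (@borel_lebesgue R n).
Local Notation shift_set v E := ((fun x : Rn => x + v)%R @^-1` E).
Variables (eps : R) (K1 K2 : Rn -> R).
Hypothesis eps0 : 0 < eps.
Hypothesis mK1 : measurable_fun setT K1.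
Hypothesis mK2 : measurable_fun setT K2.
Hypothesis K10 : forall z, 0 <= K1 z.
Hypothesis K20 : forall z, 0 <= K2 z.
Hypothesis K2_coercive : forall c : R, exists2 M : R, 0 < M &
  forall (z : Rn) i, M <= `|z ord0 i| -> c <= K2 z.

Definition interaction_energy (E : set Rn) : \bar R :=
  (interaction K1 E + interaction K2 E)%E.

Definition borel_energy (E : set Rn) : \bar R :=
  (eps%:E * perimeter E + interaction_energy E)%E.

Lemma interaction_energy_ge0 E : (0 <= interaction_energy E)%E.
Proof. by rewrite adde_ge0// interaction_ge0. Qed.

Lemma borel_energy_ge0 E : (0 <= borel_energy E)%E.
Proof.
by rewrite adde_ge0 ?interaction_energy_ge0// mule_ge0 ?perimeter_ge0// lee_fin ltW.
Qed.

Lemma le_interaction_energy E F : measurable E -> measurable F -> E `<=` F ->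
  (interaction_energy E <= interaction_energy F)%E.
Proof. by move=> mE mF EF; rewrite leeD// le_interaction. Qed.

Lemma borel_energy_shift_le E v : measurable E ->
  (borel_energy (shift_set v E) <= borel_energy E)%E.
Proof.
move=> mE; rewrite /borel_energy /interaction_energy !interaction_shift//.
by rewrite leeD2r// lee_wpmul2l ?perimeter_shift_le// lee_fin ltW.
Qed.

(** Otherwise the inner integral of the interaction would be at least [(C +
    1) / V] at every point of [E], and the interaction at least [C + 1]. *)
Lemma exists_center_bounded_moment (E : set Rn) (V C : R) : measurable E ->
  0 < V ->
  mu E = V%:E -> (interaction K2 E <= C%:E)%E ->
  exists v, (\int[mu]_(x in shift_set v E) (K2 x)%:E <= ((C + 1) / V)%:E)%E.
Proof.
move=> mE V0 EV EC.
have mK2E : measurable_fun setT (fun x => (K2 x)%:E) by exact/measurable_EFinP.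
have [[v [Ev vP]]|H] := pselect (exists v, E v /\
    (\int[mu]_(x in E) (K2 (x - v)%R)%:E <= ((C + 1) / V)%:E)%E).
  exists v; apply: le_trans vP; rewrite le_eqVlt; apply/orP; left; apply/eqP.
  rewrite -[RHS](ge0_integral_shift v mE).
  - by apply: eq_integral => x _; rewrite addrK.
  - by apply: (measurableT_comp mK2E); exact: measurable_rV_add.
  - by move=> x; rewrite lee_fin.
have C0 : 0 <= C by rewrite -lee_fin;
  exact: le_trans (interaction_ge0 K20 E) EC.
exfalso; have : (((C + 1) / V)%:E * mu E <= interaction K2 E)%E.
  rewrite -integral_cst//; apply: ge0_le_integral => //.
  - by move=> y _; rewrite lee_fin divr_ge0// ?addr_ge0// ltW.
  - by apply: measurable_funTS; exact: measurable_inner_interaction.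
  - move=> y Ey; rewrite leNgt; apply/negP => /ltW h.
    by apply: H; exists y.
rewrite EV -EFinM divfK ?gt_eqF// => /le_trans/(_ EC).
by rewrite lee_fin; lra.
Qed.

(** Markov's inequality. *)
Lemma measure_far_le (E : set Rn) (c e M : R) : measurable E -> 0 < c ->
  0 < e ->
  (\int[mu]_(x in E) (K2 x)%:E <= c%:E)%E ->
  (forall (z : Rn) i, M <= `|z ord0 i| -> c / e <= K2 z) ->
  (mu (E `\` centered_box M) <= e%:E)%E.
Proof.
move=> mE c0 e0 Ec HM.
have mK2E : measurable_fun setT (fun x => (K2 x)%:E) by exact/measurable_EFinP.
have mD : measurable (E `\` centered_box M) by apply: measurableD => //;
  exact: measurable_box.
have ce0 : 0 < c / e by rewrite divr_gt0.
have : ((c / e)%:E * mu (E `\` centered_box M) <= c%:E)%E.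
  apply: le_trans Ec; rewrite -integral_cst//.
  apply: (@le_trans _ _ (\int[mu]_(x in E `\` centered_box M) (K2 x)%:E)%E).
    apply: ge0_le_integral => //.
    - by move=> x _; rewrite lee_fin ltW.
    - exact: measurable_funTS.
    - move=> x [_ nx]; rewrite lee_fin.
      have [[i iM]|nM] := pselect (exists i, M <= `|x ord0 i|);
        first exact: HM iM.
      exfalso; apply: nx => i; have : `|x ord0 i| < M.
        by rewrite ltNge; apply/negP => h; apply: nM; exists i.
      by rewrite ltr_norml => /andP[/ltW -> ->].
  apply: ge0_subset_integral => //; first exact: measurable_funTS.
  by move=> x _; rewrite lee_fin.
rewrite -lee_pdivlMl// -EFinM; congr (_ <= _)%E.
by congr EFin; field; rewrite !gt_eqF.
Qed.

Lemma geometric_small (e : R) : 0 < e -> exists k, forall j, (k <= j)%N ->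
  2 / (2 ^ j)%:R <= e /\ j.+1%:R^-1 <= e.
Proof.
move=> e0; exists (Num.truncn (2 / e)).+1 => j kj.
have h : 2 / e <= j%:R.
  by apply: ltW; apply: lt_le_trans (truncnS_gt _) _; rewrite ler_nat.
have j0 : (0 : R) < j%:R by apply: lt_le_trans h; rewrite divr_gt0.
have h2 : j%:R <= (2 ^ j)%:R :> R by rewrite ler_nat ltnW// ltn_expl.
rewrite ler_pdivrMr// in h.
split.
- rewrite ler_pdivrMr ?ltr0n ?expn_gt0//; nra.
- rewrite -div1r ler_pdivrMr ?ltr0n// -natr1; nra.
Qed.

(** For an admissible field and a fixed [k], the integral of its divergence
    over the limit set is close to that over [B j], which is at most the
    perimeter of [B j], while the interactions of the intersection of the
    tail from [k] on are at most those of [B j] for [j >= k]. Hence the energy of [B j], itself close to [I],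
    bounds both together. Then let [k] tend to infinity and take the supremum
    over the fields. *)
Lemma minimizing_sequence_limit (V : R) (I : R) (B : nat -> set Rn) :
  (forall j, measurable (B j)) -> (forall j, mu (B j) = V%:E) ->
  (forall j, (borel_energy (B j) <= (I + j.+1%:R^-1)%:E)%E) ->
  (forall j, (mu (set_liminf B `\` B j) <= (2 / (2 ^ j)%:R)%:E)%E /\
             (mu (B j `\` set_liminf B) <= (2 / (2 ^ j)%:R)%:E)%E) ->
  mu (set_liminf B) = V%:E /\ (borel_energy (set_liminf B) <= I%:E)%E.
Proof.
move=> mB BV BI BE; set E := set_liminf B.
have mE : measurable E by exact: measurable_set_liminf.
have le_setD (A A' : set Rn) : measurable A -> measurable A' ->
    (mu A <= mu A' + mu (A `\` A'))%E.
  move=> mA mA'; apply: le_trans (measureU2 _ mA' (measurableD mA mA')).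
  apply: le_measure; rewrite ?inE//; first exact/measurableU/measurableD.
  by move=> x Ax; have [A'x|nA'x] := pselect (A' x); [left|right].
have muE : mu E = V%:E.
  apply/eqP; rewrite eq_le; apply/andP; split; apply/lee_addgt0Pr => e e0;
    have [k /(_ k (leqnn k))[ke _]] := geometric_small e0.
  - apply: (le_trans (le_setD _ _ mE (mB k))); rewrite BV leeD2l//.
    by apply: le_trans (BE k).1 _; rewrite lee_fin.
  - rewrite -(BV k); apply: (le_trans (le_setD _ _ (mB k) mE));
      rewrite leeD2l//.
    by apply: le_trans (BE k).2 _; rewrite lee_fin.
split => //.
have Eoo : (mu E < +oo)%E by rewrite muE ltry.
have Boo j : (mu (B j) < +oo)%E by rewrite BV ltry.
pose G k := \bigcap_(j in [set j | (k <= j)%N]) B j.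
have mG k : measurable (G k) by exact: measurable_tail_bigcap.
have GB k j : (k <= j)%N -> G k `<=` B j by move=> kj; exact: bigcap_inf.
have ndG : nondecreasing_seq G.
  move=> k k' kk'; apply/subsetPset => x Gx j /= k'j; apply: Gx => /=.
  exact: leq_trans k'j.
have cvgJ : interaction_energy (G k) @[k --> \oo] --> interaction_energy E.
  apply: cvgeD; last 2 first.
  - exact: cvg_interaction_bigcup.
  - exact: cvg_interaction_bigcup.
  - by apply: ge0_adde_def; rewrite inE interaction_ge0.
have key phi k : admissible phi ->
    (eps%:E * \int[mu]_(x in E) (div_field phi x)%:E + interaction_energy
      (G k) <= I%:E)%E.
  move=> aphi; have [C C0 HC] := bounded_div_field aphi.
  have mdiv : measurable_fun setT (div_field phi).
    by case: aphi => Cphi _ _; apply: continuous_measurable_rV;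
      exact: continuous_div_field.
  apply/lee_addgt0Pr => e e0.
  (* [e'] bounds the excess of energy and the measures of the differences, and
     the latter are multiplied by [eps * (2 * C)]. *)
  pose e' := e / (1 + eps * (2 * C)).
  have D0 : 0 < 1 + eps * (2 * C) by rewrite ltr_pwDl// !mulr_ge0// ltW.
  have e'0 : 0 < e' by rewrite divr_gt0.
  have [k0 Hk0] := geometric_small e'0.
  pose j := maxn k k0; have [j1 j2] := Hk0 j (leq_maxr k k0).
  have d1 : (mu (E `\` B j) <= e'%:E)%E by apply: le_trans (BE j).1 _;
    rewrite lee_fin.
  have d2 : (mu (B j `\` E) <= e'%:E)%E by apply: le_trans (BE j).2 _;
    rewrite lee_fin.
  have H := integral_bounded_setD_le mE (mB j) Eoo (Boo j) mdiv C0 HC d1 d2.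
  apply: (@le_trans _ _ (eps%:E * (perimeter (B j) + (C * e' + C * e')%:E) +
     interaction_energy (B j))%E).
    apply: leeD; last by apply: le_interaction_energy => //; apply: GB;
      exact: leq_maxl.
    apply: lee_wpmul2l; first by rewrite lee_fin ltW.
    apply: (le_trans H); rewrite leeD2r//; exact: integral_div_le_perimeter.
  rewrite ge0_muleDr ?perimeter_ge0//;
    last by rewrite lee_fin addr_ge0// mulr_ge0// ltW.
  rewrite addeAC; apply: (@le_trans _ _ ((I + j.+1%:R^-1)%:E + (eps *
    (C * e' + C * e'))%:E)%E).
    by rewrite leeD2r//; exact: BI.
  rewrite -!EFinD lee_fin -addrA lerD2l.
  have -> : e = e' + eps * (C * e' + C * e').
    by rewrite /e'; field; rewrite gt_eqF.
  by rewrite lerD2r.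
have Jfin : interaction_energy E \is a fin_num.
  rewrite ge0_fin_numE ?interaction_energy_ge0//.
  apply: (@le_lt_trans _ _ (I + 0.+1%:R^-1)%:E); last exact: ltry.
  apply: cvge_le cvgJ; apply: nearW => k.
  apply: (@le_trans _ _ (borel_energy (B k))).
    apply: (@le_trans _ _ (interaction_energy (B k)));
      first by apply: le_interaction_energy => //; exact: GB.
    by rewrite leeDr// mule_ge0 ?perimeter_ge0// lee_fin ltW.
  apply: (le_trans (BI k)); rewrite lee_fin lerD2l lef_pV2 ?posrE//.
  by rewrite ler_nat.
have perE : (perimeter E <= ((I - fine (interaction_energy E)) / eps)%:E)%E.
  apply: perimeter_le => // phi aphi; have [C C0 HC] := bounded_div_field aphi.
  have mdiv : measurable_fun setT (div_field phi).
    by case: aphi => Cphi _ _; apply: continuous_measurable_rV;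
      exact: continuous_div_field.
  have fin : (\int[mu]_(x in E) (div_field phi x)%:E)%E \is a fin_num.
    by apply: integrable_fin_num => //;
      exact: bounded_integrable mE Eoo mdiv HC.
  have : (eps%:E * \int[mu]_(x in E)
    (div_field phi x)%:E + interaction_energy E <= I%:E)%E.
    have cv : (eps%:E * \int[mu]_(x in E)
      (div_field phi x)%:E + interaction_energy (G k))%E
        @[k --> \oo] --> (eps%:E * \int[mu]_(x in E)
          (div_field phi x)%:E + interaction_energy E)%E.
      apply: cvgeD => //; last exact: cvg_cst.
      by apply: fin_num_adde_defl.
    by apply: cvge_le cv; apply: nearW => k; exact: key.
  rewrite -(fineK fin) -(fineK Jfin) -EFinM -EFinD !lee_fin => h.
  by rewrite ler_pdivlMr// mulrC lerBrDr.
rewrite /borel_energy; apply: (@le_trans _ _ (eps%:E * ((I - fine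
  (interaction_energy E)) / eps)%:E + interaction_energy E)%E).
  by rewrite leeD2r// lee_wpmul2l// lee_fin ltW.
rewrite -(fineK Jfin) -EFinM -EFinD lee_fin le_eqVlt; apply/orP; left;
  apply/eqP => /=.
by field; rewrite gt_eqF.
Qed.

End direct_method.

Section minimizer.
Context {R : realType} {n : nat}.
Local Notation Rn := 'rV[R]_n.
Local Notation mu := (@borel_lebesgue R n).
Local Notation shift_set v E := ((fun x : Rn => x + v)%R @^-1` E).

Definition borel_competitor (V : R) (E : set Rn) :=
  [/\ measurable E, mu E = V%:E & (perimeter E < +oo)%E].

(** A minimizing sequence is recentered by [exists_center_bounded_moment],
    after which the coercivity of [K2] prevents any loss of mass at
    infinity. *)
Lemma exists_borel_minimizer (eps V : R) (K1 K2 : Rn -> R) :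
  0 < eps -> 0 < V -> (0 < n)%N ->
  measurable_fun setT K1 -> measurable_fun setT K2 ->
  (forall z, 0 <= K1 z) -> (forall z, 0 <= K2 z) ->
  (forall c : R, exists2 M : R, 0 < M &
    forall (z : Rn) i, M <= `|z ord0 i| -> c <= K2 z) ->
  exists2 E : set Rn, borel_competitor V E & forall F, borel_competitor V F ->
    (borel_energy eps K1 K2 E <= borel_energy eps K1 K2 F)%E.
Proof.
move=> eps0 V0 n0 mK1 mK2 K10 K20 K2co.
set e := borel_energy eps K1 K2.
have e_ge0 E : (0 <= e E)%E by exact: borel_energy_ge0.
pose I := ereal_inf [set e F | F in borel_competitor V].
have I0 : (0 <= I)%E by apply: le_ereal_inf_tmp => _ [F _ <-].
have Ile F : borel_competitor V F -> (I <= e F)%E.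
  by move=> cF; apply: ereal_inf_lbound; exists F.
(* If the infimum is infinite, all competitors have the same energy. *)
have [Ioo|Ifin] := eqVneq I +oo%E.
  have [Q [mQ QV Qoo]] := exists_finite_perimeter V0 n0.
  exists Q; first exact: And3.
  move=> F cF.
  by have := Ile F cF; rewrite Ioo leye_eq => /eqP ->; rewrite leey.
have {}Ifin : I \is a fin_num by rewrite ge0_fin_numE// lt_neqAle Ifin leey.
have seqF m : exists F, borel_competitor V F /\ (e F <=
  (fine I + m.+1%:R^-1)%:E)%E.
  have m0 : 0 < (m.+1%:R^-1 : R) by rewrite invr_gt0.
  have [_ [F cF <-] ltF] := lb_ereal_inf_adherent m0 Ifin.
  by exists F; split => //; rewrite EFinD fineK// ltW.
pose C := fine I + 1.
have C0 : 0 <= C by rewrite addr_ge0 ?fine_ge0.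
have le_C m : fine I + m.+1%:R^-1 <= C.
  by rewrite lerD2l invf_le1 ?ler1n.
pose c := (C + 1) / V.
have c0 : 0 < c by rewrite divr_gt0// ltr_wpDl.
have seqA m : exists A : set Rn, [/\ measurable A, mu A = V%:E,
    (e A <= (fine I + m.+1%:R^-1)%:E)%E &
    (\int[mu]_(x in A) (K2 x)%:E <= c%:E)%E].
  have [F [[mF FV Foo] eF]] := seqF m.
  have K2F : (interaction K2 F <= C%:E)%E.
    apply: (@le_trans _ _ (e F)).
      rewrite /e /borel_energy /interaction_energy addeA leeDr//.
      rewrite adde_ge0 ?interaction_ge0// mule_ge0 ?perimeter_ge0//.
      by rewrite lee_fin ltW.
    by apply: (le_trans eF); rewrite lee_fin.
  have [v vP] := exists_center_bounded_moment mK2 K20 mF V0 FV K2F.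
  exists (shift_set v F); split; last exact: vP.
  - exact: measurable_preimage_add.
  - by rewrite borel_lebesgue_shift.
  - by apply: le_trans eF; exact: borel_energy_shift_le.
pose A m := projT1 (cid (seqA m)).
have mA m : measurable (A m) by rewrite /A; case: cid => ? [].
have AV m : mu (A m) = V%:E by rewrite /A; case: cid => ? [].
have eA m : (e (A m) <= (fine I + m.+1%:R^-1)%:E)%E by rewrite /A;
  case: cid => ? [].
have K2A m : (\int[mu]_(x in A m) (K2 x)%:E <= c%:E)%E by rewrite /A;
  case: cid => ? [].
have perA m : (perimeter (A m) <= (C / eps)%:E)%E.
  rewrite mulrC EFinM lee_pdivlMl//.
  apply: (@le_trans _ _ (e (A m))).
    by rewrite /e /borel_energy leeDl// interaction_energy_ge0.
  by apply: (le_trans (eA m)); rewrite lee_fin.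
have tightA d : 0 < d -> exists2 M, 0 < M &
    forall m, (mu (A m `\` centered_box M) <= d%:E)%E.
  move=> d0; have [M M0 MP] := K2co (c / d); exists M => // m.
  exact: (measure_far_le mK2 K20 (mA m) c0 d0 (K2A m) MP).
have AVle m : (mu (A m) <= V%:E)%E by rewrite AV.
have Ce0 : 0 <= C / eps by rewrite divr_ge0// ltW.
have [s sj sP] := compactness_tight_perimeter mA AVle Ce0 perA tightA.
have [||j|EV Ee] := @minimizing_sequence_limit R n eps K1 K2 eps0 mK1 mK2 K10 K20
    V (fine I) (A \o s) _ _ _ sP.
- by move=> j; exact: mA.
- by move=> j; exact: AV.
- apply: (le_trans (eA (s j))); rewrite lee_fin lerD2l lef_pV2 ?posrE//.
  by rewrite ler_nat ltnS.
exists (set_liminf (A \o s)).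
  split => //; first by apply: measurable_set_liminf => j; exact: mA.
  apply: (@le_lt_trans _ _ (eps^-1 * fine I)%:E); last exact: ltry.
  rewrite EFinM lee_pdivlMl//; apply: le_trans Ee.
  by rewrite /borel_energy leeDl// interaction_energy_ge0.
by move=> F cF; apply: (le_trans Ee); rewrite fineK//; exact: Ile.
Qed.

End minimizer.

(** * From Borel sets to Lebesgue measurable sets *)

Section lebesgue_energy.
Context {R : realType} {n : nat}.
Local Notation Rn := 'rV[R]_n.
Variables (alpha beta : R).

Definition riesz_kernel (z : Rn) : R := (enorm z `^ alpha)^-1.
Definition power_kernel (z : Rn) : R := enorm z `^ beta.

Lemma measurable_power_kernel : measurable_fun setT power_kernel.
Proof.
by apply: (measurableT_comp (measurable_powR beta)); exact: measurable_enorm.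
Qed.

Lemma measurable_riesz_kernel : measurable_fun setT riesz_kernel.
Proof.
rewrite (_ : riesz_kernel = fun z => enorm z `^ (- alpha)).
  by apply: (measurableT_comp (measurable_powR (- alpha)));
    exact: measurable_enorm.
by apply/funext => z; rewrite /riesz_kernel powRN.
Qed.

Lemma power_kernel_coercive : 0 < beta -> forall c : R, exists2 M : R, 0 < M &
  forall (z : Rn) i, M <= `|z ord0 i| -> c <= power_kernel z.
Proof.
move=> b0 c; pose a := Num.max c 1.
have a0 : 0 < a by rewrite lt_max ltr01 orbT.
exists (a `^ beta^-1); first by rewrite powR_gt0.
move=> z i Mz; apply: (@le_trans _ _ a); first by rewrite le_max lexx.
rewrite -[a in leLHS]powRr1 ?(ltW a0)// -(mulVf (lt0r_neq0 b0)) powRrM.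
rewrite /power_kernel ge0_ler_powR ?nnegrE ?powR_ge0 ?sqrtr_ge0 ?(ltW b0)//.
exact: le_trans Mz (ler_coord_enorm _ i).
Qed.

Lemma perimeter_hull (E B : set Rn) : lebesgue_measurable E ->
  measurable B -> E `<=` B -> lebesgue_rV (B `\` E) = 0%E ->
  perimeter E = perimeter B.
Proof.
move=> mE mB EB N0; congr ereal_sup; apply: eq_imagel => phi aphi.
have md : measurable_fun setT (fun x => (div_field phi x)%:E).
  by apply: measurable_div_field; case: aphi.
rewrite (integral_lebesgue_rV mE mB EB N0 md).
rewrite (@integral_lebesgue_rV _ _ B B)// ?setDv ?measure0//.
exact: borel_lebesgue_measurable.
Qed.

Lemma energy_hull (eps : R) (E B : set Rn) : lebesgue_measurable E ->
  measurable B -> E `<=` B -> lebesgue_rV (B `\` E) = 0%E ->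
  energy eps alpha beta E = borel_energy eps riesz_kernel power_kernel B.
Proof.
move=> mE mB EB N0; rewrite /energy /borel_energy /interaction_energy.
rewrite (perimeter_hull mE mB EB N0).
have k1 z : 0 <= riesz_kernel z by rewrite invr_ge0 powR_ge0.
have k2 z : 0 <= power_kernel z by rewrite powR_ge0.
rewrite -addeA; congr (_ + (_ + _))%E.
  exact: (interaction_lebesgue measurable_riesz_kernel k1 mE mB EB N0).
exact: (interaction_lebesgue measurable_power_kernel k2 mE mB EB N0).
Qed.

End lebesgue_energy.

Theorem proposition3p1 (R : realType) (d : nat) (alpha beta : R)
    (d_ge2 : (2 <= d)%N) (alpha_gt0 : 0 < alpha) (alpha_ltd : alpha < d%:R)
    (beta_gt0 : 0 < beta) (eps V : R) (eps_gt0 : 0 < eps) (V_gt0 : 0 < V) :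
  exists E : set 'rV[R]_d,
    [/\ finite_perimeter E, lebesgue_rV E = V%:E
      & forall F : set 'rV[R]_d,
          finite_perimeter F -> lebesgue_rV F = V%:E ->
          (energy eps alpha beta E <= energy eps alpha beta F)%E].
Proof.
have d_gt0 : (0 < d)%N by exact: leq_trans d_ge2.
have [E [mE EV Eoo] Emin] := @exists_borel_minimizer R d eps V
  (riesz_kernel alpha) (power_kernel beta) eps_gt0 V_gt0 d_gt0
  (measurable_riesz_kernel alpha) (measurable_power_kernel beta)
  (fun z => ltac:(by rewrite invr_ge0 powR_ge0)) (fun z => powR_ge0 _ _)
  (power_kernel_coercive beta_gt0).
have lE := borel_lebesgue_measurable mE.
exists E; split; first by [].
  by rewrite lebesgue_rV_borel.
move=> F [mF Foo] FV.
have [|B [mB FB N0]] := borel_hull mF; first by rewrite FV ltry.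
rewrite (energy_hull alpha beta eps lE mE) ?setDv ?measure0//.
rewrite (energy_hull alpha beta eps mF mB FB N0).
have BF : lebesgue_rV B = (lebesgue_rV F + lebesgue_rV (B `\` F))%E.
  rewrite -[in LHS](setDUK FB); apply: measureU; first exact: mF.
    apply: measurableD; last exact: mF.
    exact: borel_lebesgue_measurable.
  by rewrite setDIK.
apply: Emin; split; first exact: mB.
  by rewrite -lebesgue_rV_borel// BF N0 adde0.
by rewrite -(perimeter_hull mF mB FB N0).
Qed.
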